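(* Let $W$ be $W_{A_{n-1}}$, $W_{D_n}$ or $W_{B_n}$. The multiplication of the subalgebras $\mathbb C[\mathfrak h^*]$, $\mathbb C[\mathfrak h]$, $\mathcal C_{\mathfrak h^*}$, $\mathcal C_{\mathfrak h}$ and $\mathbb C W$ induces a vector space isomorphism $$\mathbb C[\mathfrak h^*]\otimes\mathcal C_{\mathfrak h^*}\otimes\mathbb C W\otimes\mathbb C[\mathfrak h]\otimes\mathcal C_{\mathfrak h}\ \xrightarrow{\ \simeq\ }\ \mathbb H^{cc}_W.$$ Equivalently, the elements $\{x^{a}c^{\epsilon}\,w\,e^{\epsilon'}y^{b}\ |\ a,b\in\mathbb Z_+^n,\ \epsilon,\epsilon'\in\mathbb Z_2^n,\ w\in W\}$ form a linear basis of $\mathbb H^{cc}_W$.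
   Context: All algebras are over $\mathbb C$; $[x,y]=xy-yx$; $\mathbb Z_+=\{0,1,2,\dots\}$. Weyl groups: $W_{A_{n-1}}=S_n$, $W_{B_n}$ is the group of signed permutations of $1,\dots,n$, $W_{D_n}$ the subgroup of even signed permutations. $s_{ij}$ is the transposition of $i,j$; $\overline s_{ij}$ is the transposition of $i,j$ coupled with sign changes at $i,j$; $\tau_i$ is the sign change at $i$. $W$ acts on the span of any family of symbols $a_1,\dots,a_n$ ($a=x,y,c,e$) by signed permutation of indices, written $a_i\mapsto a_i^\sigma$: $s_{ij}$ swaps $a_i,a_j$; $\overline s_{ij}$ sends $a_i\mapsto-a_j$, $a_j\mapsto-a_i$; $\tau_i$ sends $a_i\mapsto-a_i$; other $a_k$ are fixed. $\mathbb C[\mathfrak h^*]=\mathbb C[x_1,\dots,x_n]$, $\mathbb C[\mathfrak h]=\mathbb C[y_1,\dots,y_n]$. $\mathcal C_{2n}$ is the Clifford algebra generated by pairwise anticommuting $c_1,\dots,c_n,e_1,\dots,e_n$, each of square $1$; $\mathcal C_{\mathfrak h^*}$ (resp. $\mathcal C_{\mathfrak h}$) is the subalgebra generated by the $c_i$ (resp. the $e_i$). Let $t,u,v\in\mathbb C$ ($v$ occurs only in type $B$). $\mathbb H^{cc}_W$ is the algebra generated by $x_i,y_i$ ($1\le i\le n$), $\mathcal C_{2n}$ and $W$ subject to (in addition to the relations of $\mathcal C_{2n}$ and $W$): for all $i,j$ and $\sigma\in W$, $$x_ix_j=x_jx_i,\quad y_iy_j=y_jy_i,\quad \sigma c_i=c_i^\sigma\sigma,\quad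 \sigma e_i=e_i^\sigma\sigma,\quad \sigma x_i=x_i^\sigma\sigma,\quad \sigma y_i=y_i^\sigma\sigma,$$ $$e_ix_j=x_je_i,\quad c_ix_j=(-1)^{\delta_{ij}}x_jc_i,\quad c_iy_j=y_jc_i,\quad e_iy_j=(-1)^{\delta_{ij}}y_je_i,$$ and, with $i\neq j$: Type $A_{n-1}$: $[y_i,x_j]=u(1+c_ic_j)(1+e_je_i)s_{ij}$, $\ [y_i,x_i]=tc_ie_i-u\sum_{k\ne i}(1+c_kc_i)(1+e_ke_i)s_{ki}$. Type $D_n$: $[y_i,x_j]=u(1+c_ic_j)(1+e_je_i)s_{ij}-u(1-c_ic_j)(1-e_je_i)\overline s_{ij}$, $\ [y_i,x_i]=tc_ie_i-u\sum_{k\ne i}(1+c_kc_i)(1+e_ke_i)s_{ki}-u\sum_{k\ne i}(1-c_kc_i)(1-e_ke_i)\overline s_{ki}$. Type $B_n$: $[y_i,x_j]$ as displayed for type $D_n$, and $[y_i,x_i]=tc_ie_i-u\sum_{k\ne i}(1+c_kc_i)(1+e_ke_i)s_{ki}-u\sum_{k\ne i}(1-c_kc_i)(1-e_ke_i)\overline s_{ki}-v\tau_i$. Monomials: $x^{a}=x_1^{a_1}\cdots x_n^{a_n}$, $y^{b}=y_1^{b_1}\cdots y_n^{b_n}$, $c^\epsilon=c_1^{\epsilon_1}\cdots c_n^{\epsilon_n}$, $e^{\epsilon'}=e_1^{\epsilon'_1}\cdots e_n^{\epsilon'_n}$. *)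

(* Defs.v *)
From HB Require Import structures.
From mathcomp Require Import all_fingroup all_boot all_order all_algebra.
From mathcomp Require Import boolp monalg.

Set Implicit Arguments.
Unset Strict Implicit.
Unset Printing Implicit Defensive.

Import GRing.Theory generic_quotient.
Local Open Scope ring_scope.
Local Open Scope quotient_scope.

Declare Scope hcc_scope.
Open Scope hcc_scope.

Definition lin_indep (K : pzRingType) (V : lmodType K) (I : eqType)
    (b : I -> V) : Prop :=
  forall (s : seq I) (k : I -> K), uniq s ->
    \sum_(i <- s) k i *: b i = 0 -> forall i, i \in s -> k i = 0.

Definition spanning (K : pzRingType) (V : lmodType K) (I : eqType)
    (b : I -> V) : Prop :=
  forall v : V, exists (s : seq I) (k : I -> K), v = \sum_(i <- s) k i *: b i.

Definition is_basis (K : pzRingType) (V : lmodType K) (I : eqType)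
    (b : I -> V) : Prop :=
  lin_indep b /\ spanning b.

Section Span.
Variables (K : pzRingType) (V : lmodType K) (S : V -> Prop).

Inductive span : V -> Prop :=
| span_mem x : S x -> span x
| span_0 : span 0
| span_lin a x y : span x -> span y -> span (a *: x + y).

Definition span_pred : {pred V} := fun x => `[< span x >].

Fact span_submod : submod_closed span_pred.
Proof.
split; first by apply/asboolP; exact: span_0.
by move=> a x y /asboolP hx /asboolP hy; apply/asboolP; exact: span_lin.
Qed.

HB.instance Definition _ := GRing.isSubmodClosed.Build K V span_pred span_submod.
End Span.

Section LQuot.
Variables (K : pzRingType) (V : lmodType K) (I : submodClosed V).

(* A [submodClosed] is not a [zmodClosed] in MathComp. *)
Definition submod_zmod : {pred V} := [pred x | x \in I].

Fact submod_zmod_closed : zmod_closed submod_zmod.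
Proof.
split; first by rewrite inE rpred0.
move=> x y; rewrite !inE => hx hy.
by rewrite -[- y]scaleN1r rpredD // rpredZ.
Qed.

HB.instance Definition _ :=
  GRing.isZmodClosed.Build V submod_zmod submod_zmod_closed.

Definition lquot : Type := Quotient.quot submod_zmod.

HB.instance Definition _ := GRing.Zmodule.on lquot.
HB.instance Definition _ := Quotient.on lquot.

Lemma lquotW (P : lquot -> Type) : (forall x, P (\pi_lquot x)) -> forall x, P x.
Proof. exact: (@quotW _ lquot). Qed.

Lemma lquotP (x y : V) : (\pi_lquot x = \pi_lquot y) <-> (x - y \in I).
Proof. have -> : (x - y \in I) = (x - y \in submod_zmod) by rewrite inE.
by rewrite Quotient.idealrBE; split=> [->|/eqP]. Qed.

Lemma lquotD : {morph \pi_lquot : x y / x + y}.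
Proof. by move=> x y; exact: (raddfD \pi_(Quotient.quot submod_zmod)). Qed.

Definition lquot_scale (a : K) (x : lquot) : lquot := \pi_lquot (a *: repr x).

Lemma lquotZ a x : lquot_scale a (\pi_lquot x) = \pi_lquot (a *: x).
Proof.
by apply/lquotP; rewrite -scalerBr rpredZ //; apply/lquotP; rewrite reprK.
Qed.

Fact lquot_scaleA a b x :
  lquot_scale a (lquot_scale b x) = lquot_scale (a * b) x.
Proof. by elim/lquotW: x => x; rewrite !lquotZ scalerA. Qed.
Fact lquot_scale1 : left_id 1 lquot_scale.
Proof. by elim/lquotW=> x; rewrite !lquotZ scale1r. Qed.
Fact lquot_scaleDr : right_distributive lquot_scale +%R.
Proof.
by move=> a; elim/lquotW=> x; elim/lquotW=> y; rewrite -lquotD !lquotZ -lquotD scalerDr.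
Qed.
Fact lquot_scaleDl x : {morph lquot_scale^~ x : a b / a + b}.
Proof. by move=> a b /=; elim/lquotW: x => x; rewrite !lquotZ -lquotD scalerDl. Qed.

HB.instance Definition _ := GRing.Zmodule_isLmodule.Build K lquot
  lquot_scaleA lquot_scale1 lquot_scaleDr lquot_scaleDl.
End LQuot.

Section Tensor.
Variables (K : comNzRingType) (U V : lmodType K).

Local Notation "<[ u , v ]>" := (mkmalgU (u, v) 1 : {malg K[(U * V)%type]}).

Inductive tensor_rel : {malg K[(U * V)%type]} -> Prop :=
| tensor_Dl u u' v : tensor_rel (<[u + u', v]> - <[u, v]> - <[u', v]>)
| tensor_Dr u v v' : tensor_rel (<[u, v + v']> - <[u, v]> - <[u, v']>)
| tensor_Zl a u v : tensor_rel (<[a *: u, v]> - a *: <[u, v]>)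
| tensor_Zr a u v : tensor_rel (<[u, a *: v]> - a *: <[u, v]>).

Definition tensor : Type := lquot (span_pred tensor_rel).
HB.instance Definition _ := GRing.Lmodule.on tensor.
HB.instance Definition _ := Quotient.on tensor.

Definition tens (u : U) (v : V) : tensor := \pi_tensor <[u, v]>.
End Tensor.

Notation "U ⊗ V" := (tensor U V) (at level 40, left associativity) : type_scope.
Notation "u ⊗ v" := (tens u v) (at level 40, left associativity) : hcc_scope.

(* The type [lalgType] of MathComp requires 1 != 0, which is not known a priori
   for a presented algebra: [pres r] is therefore only given its [pzRingType]
   and [lmodType] structures, which are compatible by [pres_scaleAl] and
   [pres_scaleAr]. *)

Section Pres.
Variables (K : comNzRingType) (X : choiceType).

Fact malg_scaleAr k (a b : {malg K[{fmonom X}]}) : k *: (a * b) = a * (k *: b).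
Proof.
pose kC : {malg K[{fmonom X}]} := mkmalgU mone k.
have comm_kC : a * kC = kC * a.
  rewrite malgM_def fgmulgU malgM_def fgmulUg.
  by apply: eq_bigr => m _; rewrite mulrC mulm1 mul1m.
rewrite -(mul_malgC k b) -(mul_malgC k (a * b)).
rewrite (mulrA a kC b) comm_kC.
exact: mulrA.
Qed.

Definition free_alg := {malg K[{fmonom X}]}.
HB.instance Definition _ := GRing.Lalgebra.on free_alg.
HB.instance Definition _ := GRing.Lalgebra_isAlgebra.Build K free_alg malg_scaleAr.

Definition fgen (i : X) : free_alg := mkmalgU (fmu i) 1.

Variable r : free_alg -> free_alg -> Prop.

Inductive ideal : free_alg -> Prop :=
| ideal_rel a b : r a b -> ideal (a - b)
| ideal_0 : ideal 0
| ideal_D a b : ideal a -> ideal b -> ideal (a + b)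
| ideal_Ml a b : ideal b -> ideal (a * b)
| ideal_Mr a b : ideal a -> ideal (a * b).

Definition ideal_pred : {pred free_alg} := fun x => `[< ideal x >].

Fact ideal_submod : submod_closed ideal_pred.
Proof.
split; first by apply/asboolP; exact: ideal_0.
move=> a x y /asboolP hx /asboolP hy; apply/asboolP/ideal_D => //.
by rewrite -(mul1r x) scalerAl; exact: ideal_Ml.
Qed.

HB.instance Definition _ :=
  GRing.isSubmodClosed.Build K free_alg ideal_pred ideal_submod.

Definition pres : Type := lquot ideal_pred.
HB.instance Definition _ := GRing.Lmodule.on pres.
HB.instance Definition _ := Quotient.on pres.

Lemma presW (P : pres -> Type) : (forall a, P (\pi_pres a)) -> forall x, P x.
Proof. exact: (@quotW _ pres). Qed.

Lemma presP (a b : free_alg) : \pi_pres a = \pi_pres b <-> ideal (a - b).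
Proof. by split=> [/lquotP/asboolP|h]; last apply/lquotP/asboolP. Qed.

Definition pres_mul (x y : pres) : pres := \pi_pres (repr x * repr y).

Lemma pres_mulE a b : pres_mul (\pi_pres a) (\pi_pres b) = \pi_pres (a * b).
Proof.
apply/presP.
set a' := repr _; set b' := repr _.
have ha : ideal (a' - a) by apply/presP; rewrite reprK.
have hb : ideal (b' - b) by apply/presP; rewrite reprK.
have -> : a' * b' - a * b = (a' - a) * b' + a * (b' - b).
  by rewrite mulrBl mulrBr addrA subrK.
by apply: ideal_D; [exact: ideal_Mr | exact: ideal_Ml].
Qed.

Lemma presD : {morph \pi_pres : a b / a + b}. Proof. exact: lquotD. Qed.
Lemma presZ k a : k *: \pi_pres a = \pi_pres (k *: a). Proof. exact: lquotZ. Qed.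

Fact pres_mulA : associative pres_mul.
Proof.
by elim/presW=> x; elim/presW=> y; elim/presW=> z; rewrite !pres_mulE mulrA.
Qed.
Fact pres_mul1 : left_id (\pi_pres 1) pres_mul.
Proof. by elim/presW=> x; rewrite !pres_mulE mul1r. Qed.
Fact pres_mulr1 : right_id (\pi_pres 1) pres_mul.
Proof. by elim/presW=> x; rewrite !pres_mulE mulr1. Qed.
Fact pres_mulDl : left_distributive pres_mul +%R.
Proof.
elim/presW=> x; elim/presW=> y; elim/presW=> z.
by rewrite -presD !pres_mulE -presD mulrDl.
Qed.
Fact pres_mulDr : right_distributive pres_mul +%R.
Proof.
elim/presW=> x; elim/presW=> y; elim/presW=> z.
by rewrite -presD !pres_mulE -presD mulrDr.
Qed.

HB.instance Definition _ := GRing.Zmodule_isPzRing.Build pres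
  pres_mulA pres_mul1 pres_mulr1 pres_mulDl pres_mulDr.

Lemma presM a b : \pi_pres (a * b) = \pi_pres a * \pi_pres b.
Proof. exact: (esym (pres_mulE a b)). Qed.

Lemma pres_scaleAl k (x y : pres) : k *: (x * y) = (k *: x) * y.
Proof.
by elim/presW: x => x; elim/presW: y => y; rewrite -presM !presZ -presM scalerAl.
Qed.

Lemma pres_scaleAr k (x y : pres) : k *: (x * y) = x * (k *: y).
Proof.
by elim/presW: x => x; elim/presW: y => y; rewrite -presM !presZ -presM scalerAr.
Qed.

Definition pgen (i : X) : pres := \pi_pres (fgen i).
End Pres.

Section Subalg.
Variables (K : comNzRingType) (X : choiceType).
Variables (r : free_alg K X -> free_alg K X -> Prop) (S : pres r -> Prop).

Inductive subalg_gen : pres r -> Prop :=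
| subalg_mem a : S a -> subalg_gen a
| subalg_1 : subalg_gen 1
| subalg_lin k a b : subalg_gen a -> subalg_gen b -> subalg_gen (k *: a + b)
| subalg_M a b : subalg_gen a -> subalg_gen b -> subalg_gen (a * b).

Definition subalg_pred : {pred pres r} := fun x => `[< subalg_gen x >].

Fact subalg_submod : submod_closed subalg_pred.
Proof.
split.
  apply/asboolP; rewrite -(addNr 1) -scaleN1r.
  by apply: subalg_lin; exact: subalg_1.
by move=> a x y /asboolP hx /asboolP hy; apply/asboolP; exact: subalg_lin.
Qed.

Fact subalg_mulr : mulr_closed subalg_pred.
Proof.
split; first by apply/asboolP; exact: subalg_1.
by move=> x y /asboolP hx /asboolP hy; apply/asboolP; exact: subalg_M.
Qed.

HB.instance Definition _ :=
  GRing.isSubmodClosed.Build K (pres r) subalg_pred subalg_submod.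
HB.instance Definition _ :=
  GRing.isMulClosed.Build (pres r) subalg_pred subalg_mulr.

Record subalg := Subalg { subalg_val : pres r; _ : subalg_val \in subalg_pred }.

HB.instance Definition _ := [isSub for subalg_val].
HB.instance Definition _ := [Choice of subalg by <:].
HB.instance Definition _ := [SubChoice_isSubLmodule of subalg by <:].
HB.instance Definition _ :=
  GRing.SubZmodule_isSubPzRing.Build _ _ subalg (subringClosedP _).
End Subalg.

Variant weyl_type := TypeA | TypeB | TypeD.

Section SignedPerm.
Variable n : nat.
Local Open Scope group_scope.

(* The pair (i, b) stands for the signed index i if b = false, -i if b = true. *)
Definition sindex := ('I_n * bool)%type.
HB.instance Definition _ := Finite.on sindex.

Definition sneg (p : sindex) : sindex := (p.1, ~~ p.2).

Definition signed (w : {perm sindex}) : bool :=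
  [forall p, w (sneg p) == sneg (w p)].

Definition sign_changes (w : {perm sindex}) : nat :=
  #|[set i : 'I_n | (w (i, false)).2]|.

(* For TypeA this is the Weyl group of type A_{n-1}, i.e. S_n. *)
Definition weyl_set (T : weyl_type) : {set {perm sindex}} :=
  [set w | signed w &&
    match T with
    | TypeA => sign_changes w == 0%N
    | TypeB => true
    | TypeD => ~~ odd (sign_changes w)
    end].

Lemma signedE (w : {perm sindex}) i b : signed w ->
  w (i, b) = ((w (i, false)).1, (w (i, false)).2 (+) b).
Proof.
move=> /forallP h; case: b; last by rewrite addbF -surjective_pairing.
by rewrite addbT -[(i, true)]/(sneg (i, false)) (eqP (h _)).
Qed.

Lemma signed1 : signed 1.
Proof. by apply/forallP => p; rewrite !perm1. Qed.

Lemma signedM (w w' : {perm sindex}) : signed w -> signed w' -> signed (w * w').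
Proof.
move=> /forallP h /forallP h'; apply/forallP => p.
by rewrite !permM (eqP (h _)) (eqP (h' _)).
Qed.

Lemma sign_changes_eq0P (w : {perm sindex}) :
  reflect (forall i, (w (i, false)).2 = false) (sign_changes w == 0%N).
Proof.
rewrite cards_eq0; apply: (iffP eqP) => [h i | h].
  by have := in_set0 i; rewrite -h inE.
by apply/setP => i; rewrite !inE h.
Qed.

Lemma odd_sign_changes (w : {perm sindex}) :
  odd (sign_changes w) = \big[addb/false]_(i < n) (w (i, false)).2.
Proof.
rewrite /sign_changes -sum1dep_card big_mkcond /=.
rewrite (big_morph odd oddD (erefl : odd 0 = false)).
by apply: eq_bigr => i _; case: (w _).2.
Qed.

Lemma odd_sign_changesM (w w' : {perm sindex}) : signed w -> signed w' ->
  odd (sign_changes (w * w')) = odd (sign_changes w) (+) odd (sign_changes w').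
Proof.
move=> hw hw'; rewrite !odd_sign_changes.
pose f i := (w (i, false)).1.
have inj_f : injective f.
  move=> i j fij; pose b := (w (i, false)).2 (+) (w (j, false)).2.
  suff /perm_inj[] : w (i, false) = w (j, b) by [].
  rewrite (signedE j b hw) -/(f j) -fij /b [_ (+) (w (j, false)).2]addbC.
  by rewrite addKb -surjective_pairing.
rewrite [X in _ (+) X](reindex f (onW_bij _ (injF_bij inj_f))) /= -big_split /=.
apply: eq_bigr => i _; rewrite permM {1}[w (i, false)]surjective_pairing.
by rewrite signedE //= addbC.
Qed.

Fact weyl_group_set T : group_set (weyl_set T).
Proof.
apply/group_setP; split.
  rewrite inE signed1 /=; have h : sign_changes 1 = 0%N.
    by apply/eqP/sign_changes_eq0P => i; rewrite perm1.
  by case: T; rewrite ?h.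
move=> w w'; rewrite !inE => /andP[hw cw] /andP[hw' cw'].
rewrite signedM //=; case: T cw cw' => //.
  move=> /sign_changes_eq0P cw /sign_changes_eq0P cw'.
  apply/sign_changes_eq0P => i; rewrite permM [w _]surjective_pairing cw.
  by rewrite cw'.
by rewrite odd_sign_changesM // => /negPf-> /negPf->.
Qed.

Canonical weyl_group T : {group {perm sindex}} := group (weyl_group_set T).

Definition weyl T := subg_of (weyl_group T).
HB.instance Definition _ T := FinGroup.on (weyl T).

Definition s_perm (i j : 'I_n) : {perm sindex} :=
  tperm (i, false) (j, false) * tperm (i, true) (j, true).
Definition sbar_perm (i j : 'I_n) : {perm sindex} :=
  tperm (i, false) (j, true) * tperm (i, true) (j, false).
Definition tau_perm (i : 'I_n) : {perm sindex} := tperm (i, false) (i, true).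

(* [subg] sends a permutation outside the group to 1; the lemmas below exclude
   this for the types in whose relations these elements occur. *)
Definition s_ T i j : weyl T := subg (weyl_group T) (s_perm i j).
Definition sbar_ T i j : weyl T := subg (weyl_group T) (sbar_perm i j).
Definition tau_ T i : weyl T := subg (weyl_group T) (tau_perm i).

Let tpairE (i j k : 'I_n) (bi bj bk : bool) :
  tperm (i, bi) (j, bj) (k, bk) =
  if (k == i) && (bk == bi) then (j, bj)
  else if (k == j) && (bk == bj) then (i, bi) else (k, bk).
Proof. by rewrite permE /= !xpair_eqE. Qed.

Lemma s_permE i j k b : s_perm i j (k, b) = (tperm i j k, b).
Proof.
rewrite permM tpairE [tperm i j k]permE /=; case: b; rewrite ?andbT ?andbF /=.
  by rewrite tpairE !andbT; do 2?case: ifP.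
by do 2?case: ifP => _; rewrite tpairE !andbF.
Qed.

Lemma sbar_permE i j k b : i != j ->
  sbar_perm i j (k, b) = (tperm i j k, ((k == i) || (k == j)) (+) b).
Proof.
move=> ij; have ji : j == i = false by rewrite eq_sym (negPf ij).
rewrite permM !tpairE [tperm i j k]permE /=.
case: (eqVneq k i) => [-> | ki].
  by case: b; rewrite ?eqxx ?ji ?(negPf ij) /= ?tpairE ?eqxx ?ji ?(negPf ij).
case: (eqVneq k j) => [-> | kj].
  by case: b; rewrite ?eqxx ?ji ?(negPf ij) /= ?tpairE ?eqxx ?ji ?(negPf ij).
by case: b; rewrite /= ?tpairE ?(negPf ki) ?(negPf kj).
Qed.

Lemma tau_permE i k b : tau_perm i (k, b) = (k, (k == i) (+) b).
Proof.
by rewrite tpairE; case: b; rewrite ?andbT ?andbF; case: eqP => //= ->.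
Qed.

Lemma s_perm_in T i j : s_perm i j \in weyl_group T.
Proof.
have h : sign_changes (s_perm i j) = 0%N.
  by apply/eqP/sign_changes_eq0P => k; rewrite s_permE.
rewrite inE h; case: T; rewrite ?andbT; apply/forallP => -[k b];
  by rewrite /sneg !s_permE.
Qed.

Lemma sbar_perm_in T i j : i != j -> T <> TypeA ->
  sbar_perm i j \in weyl_group T.
Proof.
move=> ij hT; have h : sign_changes (sbar_perm i j) = 2%N.
  rewrite /sign_changes (_ : [set k | _] = [set i; j]) ?cards2 ?ij //.
  by apply/setP => k; rewrite !inE sbar_permE // addbF.
rewrite inE h; case: T hT => // _; rewrite andbT; apply/forallP => -[k b];
  by rewrite /sneg !sbar_permE //= addbN.
Qed.

Lemma tau_perm_in i : tau_perm i \in weyl_group TypeB.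
Proof.
rewrite inE andbT; apply/forallP => -[k b].
by rewrite /sneg !tau_permE /= addbN.
Qed.

End SignedPerm.

(* The vector space with basis W underlying the group algebra of W. *)
Definition group_space (K : nzRingType) (T : weyl_type) (n : nat) : Type :=
  {malg K[weyl n T]}.
HB.instance Definition _ (K : nzRingType) T n :=
  GRing.Lmodule.on (group_space K T n).
Definition group_elt (K : nzRingType) T n (w : weyl n T) : group_space K T n :=
  mkmalgU w 1.

Variant clifford_rel (A : pzRingType) (n : nat) (c e : 'I_n -> A) : A -> A -> Prop :=
| clifford_c2 i : clifford_rel c e (c i * c i) 1
| clifford_e2 i : clifford_rel c e (e i * e i) 1
| clifford_cc i j : i != j -> clifford_rel c e (c i * c j) (- (c j * c i))
| clifford_ee i j : i != j -> clifford_rel c e (e i * e j) (- (e j * e i))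
| clifford_ce i j : clifford_rel c e (c i * e j) (- (e j * c i)).

Section Clifford.
Variables (K : comNzRingType) (n : nat).

Definition clifford : Type :=
  pres (clifford_rel (fun i : 'I_n => fgen K (inl i)) (fun i : 'I_n => fgen K (inr i))).
HB.instance Definition _ := GRing.Lmodule.on clifford.
HB.instance Definition _ := GRing.PzRing.on clifford.

Definition clif_c (i : 'I_n) : clifford := pgen _ (inl i).
Definition clif_e (i : 'I_n) : clifford := pgen _ (inr i).

(* the subalgebras C_{h^*} and C_h *)
Definition clifford_c := subalg (fun a : clifford => exists i, a = clif_c i).
Definition clifford_e := subalg (fun a : clifford => exists i, a = clif_e i).
HB.instance Definition _ := GRing.Lmodule.on clifford_c.
HB.instance Definition _ := GRing.PzRing.on clifford_c.
HB.instance Definition _ := GRing.Lmodule.on clifford_e.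
HB.instance Definition _ := GRing.PzRing.on clifford_e.
End Clifford.

Section HccGen.
Variables (T : weyl_type) (n : nat).

Variant hcc_gen : Type :=
| gen_x of 'I_n | gen_y of 'I_n | gen_c of 'I_n | gen_e of 'I_n
| gen_w of weyl n T.

Definition hcc_gen_code (g : hcc_gen) : ('I_n + 'I_n) + ('I_n + 'I_n) + weyl n T :=
  match g with
  | gen_x i => inl (inl (inl i))
  | gen_y i => inl (inl (inr i))
  | gen_c i => inl (inr (inl i))
  | gen_e i => inl (inr (inr i))
  | gen_w w => inr w
  end.
Definition hcc_gen_decode (s : ('I_n + 'I_n) + ('I_n + 'I_n) + weyl n T) : hcc_gen :=
  match s with
  | inl (inl (inl i)) => gen_x i
  | inl (inl (inr i)) => gen_y i
  | inl (inr (inl i)) => gen_c i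
  | inl (inr (inr i)) => gen_e i
  | inr w => gen_w w
  end.
Fact hcc_gen_codeK : cancel hcc_gen_code hcc_gen_decode. Proof. by case. Qed.
HB.instance Definition _ := Choice.copy hcc_gen (can_type hcc_gen_codeK).
End HccGen.

Section Hcc.
Variables (K : comNzRingType) (T : weyl_type) (n : nat) (t u v : K).

Local Notation W := (weyl n T).
Local Notation F := (free_alg K (hcc_gen T n)).
Local Notation x i := (fgen K (gen_x T i)).
Local Notation y i := (fgen K (gen_y T i)).
Local Notation c i := (fgen K (gen_c T i)).
Local Notation e i := (fgen K (gen_e T i)).
Local Notation w g := (fgen K (gen_w g)).
Local Notation s i j := (w (s_ T i j)).
Local Notation sbar i j := (w (sbar_ T i j)).
Local Notation tau i := (w (tau_ T i)).

(* a_i^g, for a family of symbols a *)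
Definition wact (a : 'I_n -> F) (g : W) (i : 'I_n) : F :=
  let p := sgval g (i, false) in (-1) ^+ p.2 * a p.1.

Definition comm_offdiag (i j : 'I_n) : F :=
  match T with
  | TypeA => u *: ((1 + c i * c j) * (1 + e j * e i) * s i j)
  | TypeB | TypeD =>
      u *: ((1 + c i * c j) * (1 + e j * e i) * s i j)
      - u *: ((1 - c i * c j) * (1 - e j * e i) * sbar i j)
  end.

Definition comm_diag (i : 'I_n) : F :=
  let A := t *: (c i * e i)
    - u *: \sum_(k < n | k != i) (1 + c k * c i) * (1 + e k * e i) * s k i in
  let D := A
    - u *: \sum_(k < n | k != i) (1 - c k * c i) * (1 - e k * e i) * sbar k i in
  match T with
  | TypeA => A
  | TypeB => D - v *: tau i
  | TypeD => D
  end.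

(* In [hcc_wM], [(g' * g)%g] is the composite of permutations "g' first, then g":
   products of elements of W are composed from right to left, as needed for
   a_i |-> a_i^g to be a left action. *)
Variant hcc_rel : F -> F -> Prop :=
| hcc_w1 : hcc_rel (w 1%g) 1
| hcc_wM (g g' : W) : hcc_rel (w g * w g') (w (g' * g)%g)
| hcc_clifford a b :
    clifford_rel (fun i => c i) (fun i => e i) a b -> hcc_rel a b
| hcc_xx i j : hcc_rel (x i * x j) (x j * x i)
| hcc_yy i j : hcc_rel (y i * y j) (y j * y i)
| hcc_wc g i : hcc_rel (w g * c i) (wact (fun k => c k) g i * w g)
| hcc_we g i : hcc_rel (w g * e i) (wact (fun k => e k) g i * w g)
| hcc_wx g i : hcc_rel (w g * x i) (wact (fun k => x k) g i * w g)
| hcc_wy g i : hcc_rel (w g * y i) (wact (fun k => y k) g i * w g)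
| hcc_ex i j : hcc_rel (e i * x j) (x j * e i)
| hcc_cx i j : hcc_rel (c i * x j) ((-1) ^+ (i == j) * (x j * c i))
| hcc_cy i j : hcc_rel (c i * y j) (y j * c i)
| hcc_ey i j : hcc_rel (e i * y j) ((-1) ^+ (i == j) * (y j * e i))
| hcc_yx i j : i != j -> hcc_rel (y i * x j - x j * y i) (comm_offdiag i j)
| hcc_yxd i : hcc_rel (y i * x i - x i * y i) (comm_diag i).

Definition hcc : Type := pres hcc_rel.
HB.instance Definition _ := GRing.Lmodule.on hcc.
HB.instance Definition _ := GRing.PzRing.on hcc.

Definition hcc_x (i : 'I_n) : hcc := pgen hcc_rel (gen_x T i).
Definition hcc_y (i : 'I_n) : hcc := pgen hcc_rel (gen_y T i).
Definition hcc_c (i : 'I_n) : hcc := pgen hcc_rel (gen_c T i).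
Definition hcc_e (i : 'I_n) : hcc := pgen hcc_rel (gen_e T i).
Definition hcc_w (g : W) : hcc := pgen hcc_rel (gen_w g).

Definition monomial (a : 'I_n -> hcc) (m : 'I_n -> nat) : hcc :=
  \prod_(i < n) a i ^+ m i.

Definition hcc_index : Type :=
  {ffun 'I_n -> nat} * {ffun 'I_n -> bool} * W
  * {ffun 'I_n -> bool} * {ffun 'I_n -> nat}.
HB.instance Definition _ := Choice.on hcc_index.

Definition hcc_basis (p : hcc_index) : hcc :=
  let: (a, eps, g, eps', b) := p in
  monomial hcc_x a * monomial hcc_c (fun i => eps i : nat) * hcc_w g
  * monomial hcc_e (fun i => eps' i : nat) * monomial hcc_y b.
End Hcc.

(* Main.v *)
Require Import Defs.
From HB Require Import structures.
From mathcomp Require Import all_fingroup all_boot all_order all_algebra.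
From mathcomp Require Import boolp functions finmap monalg reals complex mpoly.
Set Implicit Arguments.
Unset Strict Implicit.
Unset Printing Implicit Defensive.
Import GRing.Theory generic_quotient.
Local Open Scope ring_scope.
Local Open Scope quotient_scope.
(* Both monalg and mpoly define this notation; the polynomials meant below are
those of mpoly. *)
Disable Notation "{ 'mpoly' R [ n ] }" :=
  (monalg.malg (monalg.cmonom 'I_n) R) : type_scope.

(** This is a theorem of Poincare-Birkhoff-Witt type: the ordered products
x^a c^eps w e^eps' y^b span the algebra because the relations sort every word,
and they are independent because the algebra acts on a module on which they act
independently.

The two halves of the relations, one for the x_i and one for the y_i, differ by
the exchange of the c_i and the e_i, and each of them is a skew product with W
and the Clifford algebra in which monomials only permute and change sign. All
interaction sits in the commutator of y_i and x_j, called [yx_comm] and defined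
uniformly for the three types in an arbitrary ring. What makes the algebra have
the expected size is that [yx_comm] is compatible with everything else: it
transforms under c_k, e_k and W as y_i x_j does ([yx_comm_c], [yx_comm_e],
[yx_comm_w]), and the Jacobi identities for y_i, x_j, x_k and for y_j, y_k, x_i
hold ([yx_comm_x], [yx_comm_y]). The second Jacobi identity is the first one
after the exchange of c and e ([yx_comm_swap]).

Spanning ([hcc_basis_spanning]). The span of the ordered products contains 1 and
absorbs left multiplication by x, c, e, w and y, in this order of proof: moving
y_j past x_i leaves the commutator, which involves c's, e's and w's only.

Independence ([hcc_basis_lin_indep]). A module is built by coinduction. Its
elements are functions of two exponents, a group element and the bits of a
Clifford monomial; such a function stands for the values of a functional on the
products gamma w_h x^a y^b, with gamma a Clifford monomial, and the algebra acts
by right multiplication on the argument of the functional. On these monomials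
c, e, w and y act by signed substitutions, so that all relations without x can be
read off.
The operator [dunkl] of x_j is defined by recursion on the degree in y, by moving
x_j through one y at a time. The Jacobi identity for two y's makes the result
independent of the choice of that y ([dunklS]). The remaining relations between
[dunkl] and c, e, w or another [dunkl] are statements that some operator D
vanishes. Such a D vanishes at y-exponent 0, where [dunkl] is a plain shift, and
the compatibilities above show that it can be moved past every y_i, so it
vanishes everywhere ([lendo_eq0]). Now let a basis element act, and evaluate at
the origin: this is, up to sign, evaluation at a point from which the index of
the basis element can be recovered ([basis_shifts], [index_point_inj]). Indicator
functions of these points separate the basis elements.

Bijectivity of the multiplication map. Tensor products of monomials span the
tensor product of the five factors, and they are mapped to the basis elements up
to the sign that comes from exchanging y^b and e^eps'. A linear map that does
this is bijective ([linear_bijective]); in particular no basis of the tensor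
product or of the Clifford algebras is needed in advance. *)

(** * Linear maps out of free modules and tensor products *)

Section LinearExtension.
Variables (K : comNzRingType) (I : choiceType) (Z : zmodType).
Variable f : I -> {additive K -> Z}.

(** The images of the basis vectors are additive maps of the coefficient, not
vectors: the same extension then serves module targets, where coefficients act
by scaling, and ring targets, where they act through a central subring. *)
Definition malg_ext (a : {malg K[I]}) : Z :=
  \sum_(i <- monalg.msupp a) f i (monalg.mcoeff i a).

Lemma malg_extEw (d : {fset I}) a : (monalg.msupp a `<=` d)%fset ->
  malg_ext a = \sum_(i <- d) f i (monalg.mcoeff i a).
Proof.
move=> sub; rewrite /malg_ext; apply/big_fset_incl => // i _.
by move/monalg.mcoeff_outdom=> ->; rewrite raddf0.
Qed.

Fact malg_ext_is_zmod_morphism : zmod_morphism malg_ext.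
Proof.
move=> a b /=.
pose d := (monalg.msupp a `|` monalg.msupp b)%fset.
rewrite (@malg_extEw d a) ?fsubsetUl // (@malg_extEw d b) ?fsubsetUr //.
rewrite (@malg_extEw d (a - b)) ?monalg.msuppB_le // -sumrB.
by apply: eq_bigr => i _; rewrite monalg.mcoeffB raddfB.
Qed.
HB.instance Definition _ :=
  GRing.isZmodMorphism.Build {malg K[I]} Z malg_ext malg_ext_is_zmod_morphism.

Lemma malg_extU i k : malg_ext (mkmalgU i k) = f i k.
Proof. by rewrite (malg_extEw monalg.msuppU_le) big_seq_fset1 monalg.mcoeffUU. Qed.

End LinearExtension.

Section ScaleTo.
Variables (K : comNzRingType) (V : lmodType K) (v : V).

Definition scale_to (k : K) : V := k *: v.

Fact scale_to_is_zmod_morphism : zmod_morphism scale_to.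
Proof. by move=> k l; rewrite /scale_to scalerBl. Qed.
HB.instance Definition _ :=
  GRing.isZmodMorphism.Build K V scale_to scale_to_is_zmod_morphism.

End ScaleTo.

Section LinearExtensionLmod.
Variables (K : comNzRingType) (I : choiceType) (V : lmodType K) (h : I -> V).

Definition lin_ext : {malg K[I]} -> V :=
  malg_ext (fun i => scale_to (h i)).

Fact lin_ext_is_linear : linear lin_ext.
Proof.
move=> k a b; rewrite /lin_ext raddfD /=; congr (_ + _).
rewrite (malg_extEw _ (monalg.msuppZ_le k a)) /malg_ext scaler_sumr.
by apply: eq_bigr => i _; rewrite monalg.mcoeffZ /= /scale_to scalerA.
Qed.
HB.instance Definition _ := GRing.isLinear.Build K {malg K[I]} V *:%R lin_ext
  lin_ext_is_linear.

Lemma lin_extU i : lin_ext (mkmalgU i 1) = h i.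
Proof. by rewrite /lin_ext malg_extU /= /scale_to scale1r. Qed.

Lemma mkmalgUZ i k : mkmalgU i k = k *: mkmalgU i 1 :> {malg K[I]}.
Proof.
by apply/monalg.malgP => j; rewrite monalg.mcoeffZ !monalg.mcoeffU mulrnAr mulr1.
Qed.

End LinearExtensionLmod.

Lemma malg_lin_ext (K : comNzRingType) (I : choiceType) (a : {malg K[I]}) :
  a = lin_ext (fun i => mkmalgU i 1) a.
Proof.
rewrite [LHS]monalgE /lin_ext /malg_ext.
by apply: eq_bigr => i _; rewrite mkmalgUZ.
Qed.

Section TensorLift.
Variables (K : comNzRingType) (U V Z : lmodType K) (f : U -> V -> Z).
Hypotheses (fl : forall w, linear (f^~ w)) (fr : forall u, linear (f u)).

Let F : {linear {malg K[(U * V)%type]} -> Z} := lin_ext (fun p => f p.1 p.2).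

Let fD u u' w : f (u + u') w = f u w + f u' w.
Proof. by have := fl w 1 u u'; rewrite !scale1r. Qed.
Let fDr u w w' : f u (w + w') = f u w + f u w'.
Proof. by have := fr u 1 w w'; rewrite !scale1r. Qed.
Let f0 w : f 0 w = 0.
Proof.
by have := fD 0 0 w; rewrite addr0 => /esym/eqP; rewrite -subr_eq0 addrK => /eqP.
Qed.
Let f0r u : f u 0 = 0.
Proof.
by have := fDr u 0 0; rewrite addr0 => /esym/eqP; rewrite -subr_eq0 addrK => /eqP.
Qed.

Let F_rel a : tensor_rel a -> F a = 0.
Proof.
case=> [u u' w|u w w'|k u w|k u w]; rewrite !raddfB /= ?linearZ_LR /= !lin_extU /=.
- by rewrite fD addrAC addrK subrr.
- by rewrite fDr addrAC addrK subrr.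
- by have := fl w k u 0; rewrite !addr0 f0 addr0 => ->; rewrite scalerN subrr.
- by have := fr u k w 0; rewrite !addr0 f0r addr0 => ->; rewrite scalerN subrr.
Qed.

Let F_span a : Defs.span (@tensor_rel K U V) a -> F a = 0.
Proof.
elim=> [b /F_rel //||k b c _ Fb _ Fc]; rewrite ?raddf0 //.
by rewrite linearP Fb Fc scaler0 addr0.
Qed.

Definition tensor_map (z : tensor U V) : Z := F (repr z).

Lemma tensor_map_pi a : tensor_map (\pi_(tensor U V) a) = F a.
Proof.
apply/eqP; rewrite -subr_eq0 /tensor_map -raddfB; apply/eqP/F_span/asboolP.
by apply/(@lquotP _ _ (span_pred (@tensor_rel K U V))); rewrite reprK.
Qed.

Lemma tensor_pi_is_linear k a b :
  \pi_(tensor U V) (k *: a + b) = k *: \pi_(tensor U V) a + \pi_(tensor U V) b.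
Proof. by rewrite (lquotD _ (k *: a) b) -(lquotZ _ k a). Qed.

Fact tensor_map_is_linear : linear tensor_map.
Proof.
move=> k; elim/lquotW => a; elim/lquotW => b.
have <- := tensor_pi_is_linear k a b.
by rewrite !tensor_map_pi linearP.
Qed.
HB.instance Definition _ := GRing.isLinear.Build K (tensor U V) Z *:%R tensor_map
  tensor_map_is_linear.

(** Linearity depends on the hypotheses [fl] and [fr], which canonical inference
cannot recover from the map; hence the bundled form. *)
Definition tensor_lift : {linear tensor U V -> Z} := tensor_map.

Lemma tensor_liftE u w : tensor_lift (tens u w) = f u w.
Proof. exact: etrans (tensor_map_pi _) (lin_extU _ _). Qed.

End TensorLift.

(** * Algebra maps out of a presented algebra *)

(** The target of these lifts is a ring with a central image of the scalars
rather than an algebra of the hierarchy, which would have to be nonzero. *)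
Section AlgebraLift.
Variables (K : comNzRingType) (X : choiceType) (A : pzRingType).
Variables (iota : {rmorphism K -> A}) (iotaC : forall k a, iota k * a = a * iota k).

Section FreeLift.
Variable g : X -> A.

Let word (m : {fmonom X}) : A := \prod_(x <- m) g x.

Definition word_term (m : {fmonom X}) (k : K) : A := iota k * word m.

Fact word_term_is_zmod_morphism m : zmod_morphism (word_term m).
Proof. by move=> k l; rewrite /word_term rmorphB mulrBl. Qed.
HB.instance Definition _ m :=
  GRing.isZmodMorphism.Build K A (word_term m) (word_term_is_zmod_morphism m).

Definition free_map (a : free_alg K X) : A := malg_ext word_term a.

Fact free_map_is_zmod_morphism : zmod_morphism free_map.
Proof. exact: malg_ext_is_zmod_morphism. Qed.
HB.instance Definition _ :=
  GRing.isZmodMorphism.Build (free_alg K X) A free_map free_map_is_zmod_morphism.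

Lemma free_mapU m k : free_map (mkmalgU m k) = iota k * word m.
Proof. exact: (@malg_extU K _ A word_term m k). Qed.

(** Centrality of [iota] is what lets the coefficients of the second factor move
past the word of the first. *)
Fact free_map_is_monoid_morphism : monoid_morphism free_map.
Proof.
have one : free_map 1 = 1.
  by rewrite free_mapU rmorph1 mul1r /word fm1 big_nil.
split=> // a b.
rewrite [a]monalgE [b]monalgE mulr_suml !raddf_sum mulr_suml.
apply: eq_bigr => m _; rewrite mulr_sumr !raddf_sum mulr_sumr.
apply: eq_bigr => m' _.
have -> : mkmalgU m (monalg.mcoeff m a) * mkmalgU m' (monalg.mcoeff m' b) =
   mkmalgU (mmul m m') (monalg.mcoeff m a * monalg.mcoeff m' b) :> free_alg K X.
  by rewrite malgM_def fgmulUU.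
rewrite /= !free_mapU rmorphM {1}/word fmM big_cat /=.
by rewrite -!mulrA; congr (_ * _); rewrite !mulrA iotaC.
Qed.
HB.instance Definition _ :=
  GRing.isMonoidMorphism.Build (free_alg K X) A free_map
    free_map_is_monoid_morphism.

Definition free_lift : {rmorphism free_alg K X -> A} := free_map.

Lemma free_liftZ k a : free_lift (k *: a) = iota k * free_lift a.
Proof.
rewrite -(monalg.mul_malgC k a) rmorphM; congr (_ * _).
by rewrite /= free_mapU /word fm1 big_nil mulr1.
Qed.

Lemma free_lift_gen x : free_lift (fgen K x) = g x.
Proof. by rewrite /free_lift /= free_mapU rmorph1 mul1r /word fmU big_seq1. Qed.

End FreeLift.

Section PresLift.
Variables (g : X -> A) (r : free_alg K X -> free_alg K X -> Prop).
Hypothesis g_rel : forall a b, r a b -> free_lift g a = free_lift g b.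

Let ideal_ker a : ideal r a -> free_lift g a = 0.
Proof.
elim=> [b c /g_rel h||b c _ hb _ hc|b c _ hc|b c _ hb].
- by rewrite raddfB /= h subrr.
- by rewrite raddf0.
- by rewrite raddfD /= hb hc addr0.
- by rewrite rmorphM /= hc mulr0.
- by rewrite rmorphM /= hb mul0r.
Qed.

Definition pres_map (z : pres r) : A := free_lift g (repr z).

Lemma pres_map_pi a : pres_map (\pi_(pres r) a) = free_lift g a.
Proof.
apply/eqP; rewrite -subr_eq0 /pres_map -raddfB; apply/eqP/ideal_ker.
by apply/presP; rewrite reprK.
Qed.

Fact pres_map_is_zmod_morphism : zmod_morphism pres_map.
Proof.
elim/presW => a; elim/presW => b.
rewrite -scaleN1r presZ -presD !pres_map_pi rmorphD free_liftZ.
by rewrite rmorphN1 mulN1r.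
Qed.
HB.instance Definition _ :=
  GRing.isZmodMorphism.Build (pres r) A pres_map pres_map_is_zmod_morphism.

Fact pres_map_is_monoid_morphism : monoid_morphism pres_map.
Proof.
split; first exact: (etrans (pres_map_pi 1) (rmorph1 _)).
by elim/presW => a; elim/presW => b; rewrite -presM !pres_map_pi /= rmorphM.
Qed.
HB.instance Definition _ :=
  GRing.isMonoidMorphism.Build (pres r) A pres_map pres_map_is_monoid_morphism.

Definition pres_lift : {rmorphism pres r -> A} := pres_map.

Lemma pres_liftZ k z : pres_lift (k *: z) = iota k * pres_lift z.
Proof.
by rewrite /pres_lift /=; elim/presW: z => a; rewrite presZ !pres_map_pi free_liftZ.
Qed.

Lemma pres_lift_gen x : pres_lift (pgen r x) = g x.
Proof. by rewrite /pres_lift /= pres_map_pi free_lift_gen. Qed.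

End PresLift.
End AlgebraLift.

(** * Signed permutations *)

Section SignedAction.
Variables (T : weyl_type) (n : nat).
Local Notation W := (weyl n T).
Implicit Types (g h : W) (i j k : 'I_n) (p : bool).

Definition wabs g i : 'I_n := (sgval g (i, false)).1.
Definition wsgn g i : bool := (sgval g (i, false)).2.

Lemma weyl_signed g : signed (sgval g).
Proof. by have := subgP g; rewrite inE => /andP[]. Qed.

Lemma weylE g i p : sgval g (i, p) = (wabs g i, wsgn g i (+) p).
Proof. exact/signedE/weyl_signed. Qed.

Lemma weyl_eq g h : wabs g =1 wabs h -> wsgn g =1 wsgn h -> g = h.
Proof.
move=> ga gs; apply: subg_inj; apply/perm.permP => -[i p].
by rewrite !weylE ga gs.
Qed.

Lemma wabs1 i : wabs 1%g i = i. Proof. by rewrite /wabs perm1. Qed.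
Lemma wsgn1 i : wsgn 1%g i = false. Proof. by rewrite /wsgn perm1. Qed.
Lemma wabsM g h i : wabs (g * h)%g i = wabs h (wabs g i).
Proof. by rewrite /wabs permM (weylE g) weylE. Qed.
Lemma wsgnM g h i : wsgn (g * h)%g i = wsgn h (wabs g i) (+) wsgn g i.
Proof. by rewrite /wsgn permM (weylE g) weylE addbF. Qed.

Lemma wabs_inj g : injective (wabs g).
Proof.
apply: (can_inj (g := wabs g^-1%g)) => i.
by rewrite -wabsM mulgV wabs1.
Qed.

Lemma wabs_bij g : bijective (wabs g). Proof. exact: injF_bij (@wabs_inj g). Qed.

Lemma wabsKV g i : wabs g (wabs g^-1%g i) = i.
Proof. by rewrite -wabsM mulVg wabs1. Qed.

(** The reflections [s_ij] ([p] false) and [sbar_ij] ([p] true) form one family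
indexed by a sign, of which type A only has the members of sign false; this
makes the relations of the three types uniform. *)
Definition refl_type p : bool := if T is TypeA then ~~ p else true.

Definition reflw p i j : W := if p then sbar_ T i j else s_ T i j.

Lemma reflwE p i j k : refl_type p -> i != j ->
  sgval (reflw p i j) (k, false) = (tperm i j k, p && ((k == i) || (k == j))).
Proof.
move=> pT ij; case: p pT => pT; rewrite /reflw /=; last first.
  by rewrite subgK ?s_permE // s_perm_in.
rewrite subgK ?sbar_permE ?addbF //; apply: sbar_perm_in => //.
by move=> eT; move: pT; rewrite /refl_type eT.
Qed.

Lemma wabs_refl p i j k : refl_type p -> i != j ->
  wabs (reflw p i j) k = tperm i j k.
Proof. by move=> pT ij; rewrite /wabs reflwE. Qed.
Lemma wsgn_refl p i j k : refl_type p -> i != j ->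
  wsgn (reflw p i j) k = p && ((k == i) || (k == j)).
Proof. by move=> pT ij; rewrite /wsgn reflwE. Qed.

Lemma reflwC p i j : refl_type p -> i != j -> reflw p i j = reflw p j i.
Proof.
move=> pT ij; have ji : j != i by rewrite eq_sym.
apply: weyl_eq => k; rewrite ?wabs_refl ?wsgn_refl //; first by rewrite tpermC.
by rewrite orbC.
Qed.

Lemma wsgn_typeA g i : T = TypeA -> wsgn g i = false.
Proof.
have sc0 T' (s : {perm sindex n}) : s \in weyl_set n T' -> T' = TypeA ->
    sign_changes s == 0%N.
  by move=> + eT; rewrite eT inE => /andP[].
by move=> /(sc0 _ _ (subgP g)) /sign_changes_eq0P sc; exact: sc.
Qed.

Lemma refl_type_wsgn p g i j :
  refl_type (p (+) wsgn g i (+) wsgn g j) = refl_type p.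
Proof.
move: (@wsgn_typeA g i) (@wsgn_typeA g j); rewrite /refl_type.
by case: (T) => // /(_ erefl)-> /(_ erefl)->; rewrite !addbF.
Qed.

(** A conjugated reflection exchanges the images of [i] and [j], and changes
kind once for each of the two indices at which [g] changes the sign. *)
Lemma reflw_conj p g i j : refl_type p -> i != j ->
  (reflw p i j * g)%g =
  (g * reflw (p (+) wsgn g i (+) wsgn g j) (wabs g i) (wabs g j))%g.
Proof.
move=> pT ij; set q := _ (+) _.
have qT : refl_type q by rewrite refl_type_wsgn.
have gij : wabs g i != wabs g j by rewrite (inj_eq (@wabs_inj g)).
apply: weyl_eq => k.
  rewrite !wabsM !wabs_refl //.
  by rewrite !permE /= !(inj_eq (@wabs_inj g)); do 2?case: ifP.
rewrite !wsgnM !wabs_refl // !wsgn_refl // permE /= !(inj_eq (@wabs_inj g)).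
rewrite /q; case: (eqVneq k i) => [->|ki]; last case: (eqVneq k j) => [->|kj];
by rewrite /= ?orbT ?andbT ?andbF; case: (wsgn g _); case: (wsgn g _); case: (p).
Qed.

Lemma wtau g i : T = TypeB ->
  (tau_ T i * g)%g = (g * tau_ T (wabs g i))%g.
Proof.
move=> eT; have tauE j k : sgval (tau_ T j) (k, false) = (k, k == j).
  rewrite subgK ?tau_permE ?addbF //; by move: (tau_perm_in j); rewrite -eT.
apply: weyl_eq => k; rewrite ?wabsM ?wsgnM /wabs ?tauE //=.
rewrite /wsgn !tauE /= -/(wabs g k) -/(wabs g i) (inj_eq (@wabs_inj g)).
by rewrite addbC.
Qed.

Lemma wabs_tau i k : T = TypeB -> wabs (tau_ T i) k = k.
Proof.
move=> eT; rewrite /wabs subgK ?tau_permE //.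
by move: (tau_perm_in i); rewrite -eT.
Qed.
Lemma wsgn_tau i k : T = TypeB -> wsgn (tau_ T i) k = (k == i).
Proof.
move=> eT; rewrite /wsgn subgK ?tau_permE ?addbF //.
by move: (tau_perm_in i); rewrite -eT.
Qed.

End SignedAction.

(** * The relations in an arbitrary ring *)

Section Relations.
Variables (T : weyl_type) (n : nat) (A : pzRingType).
Local Notation W := (weyl n T).
Implicit Types (g h : W) (i j k : 'I_n) (p q : bool).

Definition signed_act (a : 'I_n -> A) g i : A := (-1) ^+ wsgn g i * a (wabs g i).

(** The defining relations are split into two records so that both halves of
the algebra satisfy the same one: [polar x c e w] for the x_i, and
[polar y e c w], with c and e exchanged, for the y_i. Whatever is proved for the
x_i then holds for the y_i by symmetry. *)
Record cliff_weyl (c e : 'I_n -> A) (w : W -> A) : Prop := CliffWeyl {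
  cw_clifford : forall a b, clifford_rel c e a b -> a = b;
  cw_1 : w 1%g = 1;
  cw_M : forall g h, w g * w h = w (h * g)%g;
  cw_c : forall g i, w g * c i = signed_act c g i * w g;
  cw_e : forall g i, w g * e i = signed_act e g i * w g }.

Record polar (x c e : 'I_n -> A) (w : W -> A) : Prop := Polar {
  po_cx : forall i j, c i * x j = (-1) ^+ (i == j) * (x j * c i);
  po_ex : forall i j, e i * x j = x j * e i;
  po_wx : forall g i, w g * x i = signed_act x g i * w g }.

Lemma signK p (a : A) : (-1) ^+ p * ((-1) ^+ p * a) = a.
Proof. by rewrite mulrA -signr_addb addbb mul1r. Qed.

Lemma signCA p (a b : A) : a * ((-1) ^+ p * b) = (-1) ^+ p * (a * b).
Proof. by rewrite mulrA (commr_sign a p) mulrA. Qed.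

Lemma signMM p q (a b : A) :
  (-1) ^+ p * a * ((-1) ^+ q * b) = (-1) ^+ (p (+) q) * (a * b).
Proof. by rewrite signCA signr_addb -!mulrA signCA. Qed.

Lemma cliff_weyl_sym c e w : cliff_weyl c e w -> cliff_weyl e c w.
Proof.
move=> cw; split; last 4 first.
- exact: cw_1 cw.
- exact: cw_M cw.
- exact: cw_e cw.
- exact: cw_c cw.
move=> a b [i|i|i j ij|i j ij|i j].
- exact/(cw_clifford cw)/clifford_e2.
- exact/(cw_clifford cw)/clifford_c2.
- exact/(cw_clifford cw)/clifford_ee.
- exact/(cw_clifford cw)/clifford_cc.
- by rewrite (cw_clifford cw (clifford_ce c e j i)) opprK.
Qed.

Section ReflFactor.
(* Both the c_i and the e_i will play the role of [c]. *)
Variables (c : 'I_n -> A) (w : W -> A).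
Hypothesis c2 : forall i, c i * c i = 1.
Hypothesis cc : forall i j, i != j -> c i * c j = - (c j * c i).
Hypothesis wc : forall g i, w g * c i = signed_act c g i * w g.

Definition refl_factor p i j : A := 1 + (-1) ^+ p * (c i * c j).

Lemma w_refl_act (x : 'I_n -> A) p i j k : refl_type T p -> i != j ->
  signed_act x (reflw T p i j) k = (-1) ^+ (p && ((k == i) || (k == j))) * x (tperm i j k).
Proof. by move=> pT ij; rewrite /signed_act wsgn_refl // wabs_refl. Qed.

Lemma refl_factor_flip p i j : i != j -> refl_factor p i j = refl_factor (~~ p) j i.
Proof. by move=> ij; rewrite /refl_factor cc // signrN mulrN mulNr. Qed.

Lemma refl_factor_comm p i j k (ij : i != j) : k != i -> k != j ->
  c k * refl_factor p i j = refl_factor p i j * c k.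
Proof.
move=> ki kj; rewrite mulrDl mulrDr mul1r mulr1 signCA -mulrA; congr (_ + _ * _).
by rewrite mulrA (cc ki) -mulrA mulNr -mulrA (cc kj) !mulrN opprK mulrA.
Qed.

Lemma refl_factor_perm p i j k : i != j ->
  c k * refl_factor p i j = (-1) ^+ ((k == j) (+) (p && ((k == i) || (k == j)))) *
                     (refl_factor p i j * c (tperm i j k)).
Proof.
move=> ij; case: (eqVneq k i) => [->|ki].
  rewrite (negPf ij) /= andbT tpermL mulrDr mulrDl mulr1 mul1r mulrDr.
  by rewrite signCA mulrA c2 mul1r -!mulrA c2 mulr1 signK addrC.
case: (eqVneq k j) => [->|kj].
  rewrite /= andbT tpermR mulrDr mulrDl mulr1 mul1r mulrDr signrN !mulNr.
  rewrite -[_ * _ * c i]mulrA signK signCA (cc ij) !mulrN !mulNr opprK.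
  by rewrite (mulrA (c j)) c2 mul1r -mulrA c2 mulr1 addrC.
by rewrite /= andbF !mul1r tpermD ?refl_factor_comm // eq_sym.
Qed.

(** For [k = j] the sign appears because c_j turns 1 + c_i c_j into c_j - c_i
from the left, but into c_i - c_j from the right, through the reflection; the
other cases are similar. *)
Lemma refl_factor_refl p i j k : refl_type T p -> i != j ->
  c k * (refl_factor p i j * w (reflw T p i j)) =
  (-1) ^+ (k == j) * (refl_factor p i j * w (reflw T p i j) * c k).
Proof.
move=> pT ij; rewrite -[refl_factor p i j * _ * _]mulrA wc w_refl_act // -!mulrA.
by rewrite signCA mulrA refl_factor_perm // signr_addb -!mulrA.
Qed.

Lemma refl_factor_act p g i j :
  w g * refl_factor p i j =
  refl_factor (p (+) wsgn g i (+) wsgn g j) (wabs g i) (wabs g j) * w g.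
Proof.
rewrite mulrDr mulrDl mulr1 mul1r signCA mulrA wc; congr (_ + _).
rewrite -[_ * w g * c j]mulrA wc /signed_act -!mulrA signCA !signr_addb -!mulrA.
by rewrite signCA; congr (_ * (_ * _)); rewrite signCA.
Qed.

Section ReflFactorPolar.
Variable x : 'I_n -> A.
Hypothesis cx : forall i j, c i * x j = (-1) ^+ (i == j) * (x j * c i).

Lemma refl_factor_x p i j k : i != j ->
  refl_factor p i j * x k = x k * refl_factor (p (+) ((k == i) || (k == j))) i j.
Proof.
move=> ij; have cck : c i * c j * x k =
    (-1) ^+ ((k == i) || (k == j)) * (x k * (c i * c j)).
  rewrite -mulrA cx signCA (mulrA (c i)) cx -!mulrA [LHS]mulrA.
  rewrite -signr_addb !(eq_sym _ k); congr (_ ^+ nat_of_bool _ * _).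
  by case: (eqVneq k i) => [->|]; rewrite ?(negPf ij) ?addbF.
rewrite mulrDl mulrDr mulr1 mul1r signCA -mulrA cck signr_addb; congr (_ + _).
exact: mulrA.
Qed.

End ReflFactorPolar.
End ReflFactor.
End Relations.

Section CliffordWeylTheory.
Variables (T : weyl_type) (n : nat) (A : pzRingType).
Variables (c e : 'I_n -> A) (w : weyl n T -> A).
Hypothesis cw : cliff_weyl c e w.

Lemma cw_c2 i : c i * c i = 1. Proof. exact/(cw_clifford cw)/clifford_c2. Qed.
Lemma cw_e2 i : e i * e i = 1. Proof. exact/(cw_clifford cw)/clifford_e2. Qed.
Lemma cw_cc i j : i != j -> c i * c j = - (c j * c i).
Proof. by move=> ij; exact/(cw_clifford cw)/clifford_cc. Qed.
Lemma cw_ee i j : i != j -> e i * e j = - (e j * e i).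
Proof. by move=> ij; exact/(cw_clifford cw)/clifford_ee. Qed.
Lemma cw_ce i j : c i * e j = - (e j * c i).
Proof. exact/(cw_clifford cw)/clifford_ce. Qed.

End CliffordWeylTheory.

Definition is_typeB (T : weyl_type) : bool := if T is TypeB then true else false.

Lemma is_typeBP T : is_typeB T -> T = TypeB. Proof. by case: T. Qed.

Section Deformation.
Variables (T : weyl_type) (n : nat) (K : comNzRingType) (A : pzRingType).
Variable (iota : {rmorphism K -> A}).
Local Notation W := (weyl n T).
Implicit Types (g h : W) (i j k : 'I_n) (p q : bool).

Section Terms.
Variables (c e : 'I_n -> A) (w : W -> A) (t u v : K).

(** A reflection contributes [off_term] to the commutator of y_i and x_j, and
[diag_term] to that of y_i and x_i: the order of the two e's differs. Moving x_i
or x_j past a term changes the sign in its c-factor, which amounts to exchanging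
the two c's; so the two kinds of terms trade places. *)
Definition off_term p i j : A :=
  refl_factor c p i j * (refl_factor e p j i * w (reflw T p i j)).
Definition diag_term p i j : A :=
  refl_factor c p i j * (refl_factor e p i j * w (reflw T p i j)).

Definition off_comm i j : A :=
  iota u * \sum_(p | refl_type T p) (-1) ^+ p * off_term p i j.

Definition tau_term i : A := if is_typeB T then iota v * w (tau_ T i) else 0.

Definition diag_comm i : A :=
  iota t * (c i * e i)
  - iota u * (\sum_(k | k != i) \sum_(p | refl_type T p) diag_term p k i)
  - tau_term i.

Definition yx_comm i j : A := if i == j then diag_comm i else off_comm i j.

End Terms.

Section Theory.
Hypothesis iotaC : forall z a, iota z * a = a * iota z.
Variables (c e : 'I_n -> A) (w : W -> A) (t u v : K).
Hypothesis cw : cliff_weyl c e w.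

Let c2 := cw_c2 cw.
Let e2 := cw_e2 cw.
Let cc := cw_cc cw.
Let ee := cw_ee cw.
Let ce := cw_ce cw.

Lemma iotaCA z a b : a * (iota z * b) = iota z * (a * b).
Proof. by rewrite mulrA -iotaC mulrA. Qed.

Let c_refl_factor_e p i j k : c k * refl_factor e p i j = refl_factor e p i j * c k.
Proof.
rewrite mulrDr mulrDl mulr1 mul1r signCA -mulrA; congr (_ + _ * _).
by rewrite mulrA ce mulNr -mulrA ce mulrN opprK mulrA.
Qed.

Let e_refl_factor_c p i j k : e k * refl_factor c p i j = refl_factor c p i j * e k.
Proof.
rewrite mulrDr mulrDl mulr1 mul1r signCA -mulrA; congr (_ + _ * _).
rewrite -[RHS]mulrA ce mulrN (mulrA (c i)) ce mulNr opprK.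
by rewrite mulrA.
Qed.

Let refl_factorC p q i j k l :
  refl_factor c p i j * refl_factor e q k l =
  refl_factor e q k l * refl_factor c p i j.
Proof.
rewrite [refl_factor c p i j]/refl_factor mulrDl mul1r [RHS]mulrDr mulr1.
rewrite signCA -mulrA; congr (_ + _ * _).
by rewrite -mulrA c_refl_factor_e mulrA c_refl_factor_e mulrA.
Qed.

Lemma refl_factorCA p q i j k l a :
  refl_factor c p i j * (refl_factor e q k l * a) =
  refl_factor e q k l * (refl_factor c p i j * a).
Proof. by rewrite mulrA refl_factorC mulrA. Qed.

Lemma off_term_c p i j k : refl_type T p -> i != j ->
  c k * off_term c e w p i j = (-1) ^+ (k == j) * (off_term c e w p i j * c k).
Proof.
move=> pT ij; rewrite /off_term refl_factorCA.
rewrite [c k * _]mulrA c_refl_factor_e -mulrA (refl_factor_refl c2 cc (cw_c cw)) //.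
by rewrite signCA !mulrA.
Qed.

Lemma diag_term_c p i j k : refl_type T p -> i != j ->
  c k * diag_term c e w p i j = (-1) ^+ (k == j) * (diag_term c e w p i j * c k).
Proof.
move=> pT ij; rewrite /diag_term refl_factorCA.
rewrite [c k * _]mulrA c_refl_factor_e -mulrA (refl_factor_refl c2 cc (cw_c cw)) //.
by rewrite signCA !mulrA.
Qed.

Lemma off_term_e p i j k : refl_type T p -> i != j ->
  e k * off_term c e w p i j = (-1) ^+ (k == i) * (off_term c e w p i j * e k).
Proof.
move=> pT ij; rewrite /off_term reflwC //.
rewrite [e k * _]mulrA e_refl_factor_c -mulrA.
rewrite (refl_factor_refl e2 ee (cw_e cw)) 1?eq_sym //.
by rewrite signCA !mulrA.
Qed.

Lemma diag_term_e p i j k : refl_type T p -> i != j ->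
  e k * diag_term c e w p i j = (-1) ^+ (k == j) * (diag_term c e w p i j * e k).
Proof.
move=> pT ij; rewrite /diag_term.
rewrite [e k * _]mulrA e_refl_factor_c -mulrA (refl_factor_refl e2 ee (cw_e cw)) //.
by rewrite signCA !mulrA.
Qed.

Let tau_commute (a : 'I_n -> A) k i :
  (forall g i, w g * a i = signed_act a g i * w g) ->
  a k * tau_term w v i = (-1) ^+ (k == i) * (tau_term w v i * a k).
Proof.
rewrite /tau_term => wa; have := @wabs_tau T n i k; have := @wsgn_tau T n i k.
case: ifP => [/is_typeBP eT /(_ eT) s /(_ eT) b|_ _ _]; last by rewrite mulr0 mul0r mulr0.
rewrite iotaCA -mulrA wa /signed_act s b -mulrA iotaCA; congr (_ * _).
by rewrite signK.
Qed.

Let ce_c k i : c k * (c i * e i) = (-1) ^+ (k == i) * (c i * e i * c k).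
Proof.
rewrite -mulrA (_ : e i * c k = - (c k * e i)); last by rewrite ce opprK.
case: (eqVneq k i) => [->|ki]; first by rewrite mulrN mulN1r opprK.
by rewrite mul1r mulrN !mulrA (cc ki) mulNr.
Qed.

Let ce_e k i : e k * (c i * e i) = (-1) ^+ (k == i) * (c i * e i * e k).
Proof.
rewrite mulrA (_ : e k * c i = - (c i * e k)); last by rewrite ce opprK.
case: (eqVneq k i) => [->|ki]; first by rewrite mulNr mulN1r.
by rewrite mul1r mulNr -[c i * e k * e i]mulrA (ee ki) mulrN opprK mulrA.
Qed.

Let sum_commute (I : finType) (P : pred I) (F : I -> A) (a : A) p :
  (forall z, P z -> a * F z = (-1) ^+ p * (F z * a)) ->
  a * (\sum_(z | P z) F z) = (-1) ^+ p * ((\sum_(z | P z) F z) * a).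
Proof. by move=> h; rewrite mulr_sumr mulr_suml mulr_sumr; apply: eq_bigr. Qed.

(** Since c_k commutes with y_i, it has to move past y_i x_j - x_j y_i with the
sign it has for x_j alone. *)
Lemma yx_comm_c i j k :
  c k * yx_comm c e w t u v i j = (-1) ^+ (k == j) * (yx_comm c e w t u v i j * c k).
Proof.
rewrite /yx_comm; case: (eqVneq i j) => [->|ij].
  rewrite /diag_comm !mulrBr !mulrBl !mulrBr; congr (_ - _ - _).
  - by rewrite iotaCA ce_c -(mulrA (iota t)) -(signCA _ (iota t)).
  - rewrite iotaCA -(mulrA (iota u)) -(signCA _ (iota u)); congr (_ * _).
    by do 2!(apply: sum_commute => ? ?); exact: diag_term_c.
  - exact/tau_commute/(cw_c cw).
rewrite /off_comm iotaCA -(mulrA (iota u)) -(signCA _ (iota u)); congr (_ * _).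
apply: sum_commute => p pT; rewrite signCA off_term_c //.
by rewrite -!mulrA signCA.
Qed.

(** Dually, e_k commutes with x_j and sees only y_i. *)
Lemma yx_comm_e i j k :
  e k * yx_comm c e w t u v i j = (-1) ^+ (k == i) * (yx_comm c e w t u v i j * e k).
Proof.
rewrite /yx_comm; case: (eqVneq i j) => [->|ij].
  rewrite /diag_comm !mulrBr !mulrBl !mulrBr; congr (_ - _ - _).
  - by rewrite iotaCA ce_e -(mulrA (iota t)) -(signCA _ (iota t)).
  - rewrite iotaCA -(mulrA (iota u)) -(signCA _ (iota u)); congr (_ * _).
    by do 2!(apply: sum_commute => ? ?); exact: diag_term_e.
  - exact/tau_commute/(cw_e cw).
rewrite /off_comm iotaCA -(mulrA (iota u)) -(signCA _ (iota u)); congr (_ * _).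
apply: sum_commute => p pT; rewrite signCA off_term_e //.
by rewrite -!mulrA signCA.
Qed.

Let w_refl g p i j : refl_type T p -> i != j ->
  w g * w (reflw T p i j) =
  w (reflw T (p (+) wsgn g i (+) wsgn g j) (wabs g i) (wabs g j)) * w g.
Proof. by move=> pT ij; rewrite !(cw_M cw) reflw_conj. Qed.

Lemma off_term_w g p i j : refl_type T p -> i != j ->
  w g * off_term c e w p i j =
  off_term c e w (p (+) wsgn g i (+) wsgn g j) (wabs g i) (wabs g j) * w g.
Proof.
move=> pT ij; rewrite /off_term mulrA (refl_factor_act (cw_c cw)) -mulrA.
rewrite [w g * _]mulrA (refl_factor_act (cw_e cw)) -(mulrA _ (w g)) w_refl //.
by rewrite (addbAC p (wsgn g j)) !mulrA.
Qed.

Lemma diag_term_w g p i j : refl_type T p -> i != j ->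
  w g * diag_term c e w p i j =
  diag_term c e w (p (+) wsgn g i (+) wsgn g j) (wabs g i) (wabs g j) * w g.
Proof.
move=> pT ij; rewrite /diag_term mulrA (refl_factor_act (cw_c cw)) -mulrA.
rewrite [w g * _]mulrA (refl_factor_act (cw_e cw)) -(mulrA _ (w g)) w_refl //.
by rewrite !mulrA.
Qed.

(** Both reflection sums are permuted by [g]: the pair of indices by [wabs g],
and the kind of reflection by the signs of [g] at the two indices, which also
produces the sign of the off-diagonal terms. *)
Lemma yx_comm_w g i j :
  w g * yx_comm c e w t u v i j =
  (-1) ^+ (wsgn g i (+) wsgn g j) *
    (yx_comm c e w t u v (wabs g i) (wabs g j) * w g).
Proof.
have flip k l : bijective (fun p => p (+) wsgn g k (+) wsgn g l).
  by apply: inv_bij => p; case: p; case: (wsgn g k); case: (wsgn g l).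
rewrite /yx_comm (inj_eq (@wabs_inj _ _ g)); case: (eqVneq i j) => [->|ij].
  rewrite addbb mul1r /diag_comm !mulrBr !mulrBl; congr (_ - _ - _).
  - rewrite iotaCA -mulrA; congr (_ * _).
    rewrite mulrA (cw_c cw) -mulrA (cw_e cw) /signed_act -!mulrA signCA.
    by rewrite signK.
  - rewrite iotaCA -mulrA; congr (_ * _).
    rewrite mulr_sumr mulr_suml.
    rewrite [RHS](reindex (wabs g)) /=; last exact/onW_bij/wabs_bij.
    rewrite [RHS](eq_bigl (fun k => k != j)) => [|k]; last first.
      by rewrite (inj_eq (@wabs_inj _ _ g)).
    apply: eq_bigr => k kj; rewrite mulr_sumr mulr_suml.
    rewrite [RHS](reindex _ (onW_bij _ (flip k j))) /=.
    rewrite [RHS](eq_bigl (refl_type T)) => [|p]; last by rewrite refl_type_wsgn.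
    by apply: eq_bigr => p pT; rewrite diag_term_w.
  - rewrite /tau_term; have := @wtau T n g j.
    case: ifP => [/is_typeBP eT /(_ eT) h|_ _]; last by rewrite mulr0 mul0r.
    by rewrite iotaCA -mulrA !(cw_M cw) h.
rewrite /off_comm iotaCA -(mulrA (iota u)) -(signCA _ (iota u)); congr (_ * _).
rewrite mulr_sumr mulr_suml mulr_sumr.
rewrite [RHS](reindex _ (onW_bij _ (flip i j))) /=.
rewrite [RHS](eq_bigl (refl_type T)) => [|p]; last by rewrite refl_type_wsgn.
apply: eq_bigr => p pT; rewrite signCA off_term_w //.
rewrite -!mulrA [RHS]mulrA -signr_addb; congr ((-1) ^+ nat_of_bool _ * _).
by case: (wsgn g i); case: (wsgn g j); case: (p).
Qed.

End Theory.
End Deformation.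

(** * Jacobi identities *)

Section Jacobi.
Variables (T : weyl_type) (n : nat) (K : comNzRingType) (A : pzRingType).
Variable (iota : {rmorphism K -> A}).
Hypothesis iotaC : forall z a, iota z * a = a * iota z.
Implicit Types (i j k : 'I_n) (p q : bool).

Definition bracket (a b : A) : A := a * b - b * a.

Let bracketBl a b d : bracket (a - b) d = bracket a d - bracket b d.
Proof.
rewrite /bracket mulrBl mulrBr !opprB -!addrA; congr (_ + _).
rewrite addrCA [RHS]addrCA; congr (_ + _); exact: addrC.
Qed.

Let bracket_sum (I : finType) (P : pred I) (F : I -> A) d :
  bracket (\sum_(z | P z) F z) d = \sum_(z | P z) bracket (F z) d.
Proof. by rewrite /bracket mulr_suml mulr_sumr -sumrB. Qed.

Let bracket_iota z a d : bracket (iota z * a) d = iota z * bracket a d.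
Proof. by rewrite /bracket -mulrA (iotaCA iotaC) mulrBr. Qed.

Let bracket_sign p a d : bracket ((-1) ^+ p * a) d = (-1) ^+ p * bracket a d.
Proof. by rewrite /bracket -mulrA signCA mulrBr. Qed.

Section FirstJacobi.
Variables (x c e : 'I_n -> A) (w : weyl n T -> A) (t u v : K).
Hypotheses (cw : cliff_weyl c e w) (xp : polar x c e w).

Let refl_factor_e_x p i j k : refl_factor e p i j * x k = x k * refl_factor e p i j.
Proof.
rewrite mulrDl [RHS]mulrDr mulr1 mul1r signCA -mulrA; congr (_ + _ * _).
by rewrite -mulrA (po_ex xp) mulrA (po_ex xp) mulrA.
Qed.

(* [q] is independent of [p], so that one computation covers the off-diagonal
and the diagonal term of a reflection. *)
Let refl_x p q i j k a b : refl_type T p -> i != j ->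
  let m := (k == i) || (k == j) in
  refl_factor c q i j * (refl_factor e p a b * w (reflw T p i j)) * x k =
  (-1) ^+ (p && m) * (x (tperm i j k) *
    (refl_factor c (q (+) m) i j * (refl_factor e p a b * w (reflw T p i j)))).
Proof.
move=> pT ij m.
have mE : (tperm i j k == i) || (tperm i j k == j) = m.
  rewrite /m permE /=; case: (eqVneq k i) => [_|ki]; first by rewrite eqxx orbT.
  by case: (eqVneq k j) => [_|kj]; rewrite ?eqxx ?(negPf ki) ?(negPf kj).
rewrite -!mulrA (po_wx xp) w_refl_act // -/m -mulrA !signCA; congr (_ * _).
rewrite (mulrA (refl_factor e _ _ _)) refl_factor_e_x -mulrA mulrA.
by rewrite (refl_factor_x (po_cx xp)) // mE !mulrA.
Qed.

Let off_x_far p i j k : refl_type T p -> i != j -> k != i -> k != j ->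
  bracket (off_term c e w p i j) (x k) = 0.
Proof.
move=> pT ij ki kj; rewrite /bracket refl_x // (negPf ki) (negPf kj) /=.
by rewrite andbF mul1r addbF tpermD 1?eq_sym // subrr.
Qed.

Let diag_x_far p i j k : refl_type T p -> i != j -> k != i -> k != j ->
  bracket (diag_term c e w p i j) (x k) = 0.
Proof.
move=> pT ij ki kj; rewrite /bracket refl_x // (negPf ki) (negPf kj) /=.
by rewrite andbF mul1r addbF tpermD 1?eq_sym // subrr.
Qed.

Let off_x p i j : refl_type T p -> i != j ->
  off_term c e w p i j * x i = (-1) ^+ p * (x j * diag_term c e w p j i).
Proof.
move=> pT ij; have ji : j != i by rewrite eq_sym.
rewrite refl_x // eqxx /= andbT addbT tpermL /diag_term.
by rewrite (refl_factor_flip (cw_cc cw) p ji) (reflwC pT ji).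
Qed.

Let diag_x p i j : refl_type T p -> i != j ->
  diag_term c e w p j i * x j = (-1) ^+ p * (x i * off_term c e w p i j).
Proof.
move=> pT ij; have ji : j != i by rewrite eq_sym.
rewrite refl_x // eqxx /= andbT addbT tpermL /off_term.
by rewrite (refl_factor_flip (cw_cc cw) p ij) (reflwC pT ij).
Qed.

(* Both sides are x_j D - (-1)^p x_i O, with D the diagonal and O the
off-diagonal term of the reflection. *)
Let off_diag_x p i j : refl_type T p -> i != j ->
  (-1) ^+ p * bracket (off_term c e w p i j) (x i) =
  - bracket (diag_term c e w p j i) (x j).
Proof.
by move=> pT ij; rewrite /bracket off_x // diag_x // mulrBr signK opprB.
Qed.

Let off_diag_comm_x i j : i != j ->
  bracket (off_comm iota c e w u i j) (x i) =
  bracket (diag_comm iota c e w t u v i) (x j).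
Proof.
move=> ij; have ji : j != i by rewrite eq_sym.
rewrite /off_comm /diag_comm !bracketBl !bracket_iota !bracket_sum.
have -> : bracket (c i * e i) (x j) = 0.
  rewrite /bracket -mulrA (po_ex xp) mulrA (po_cx xp) (negPf ij) mul1r.
  by rewrite -mulrA subrr.
have -> : bracket (tau_term iota w v i) (x j) = 0.
  rewrite /tau_term; case: ifP => [/is_typeBP eT|_]; last first.
    by rewrite /bracket mul0r mulr0 subrr.
  rewrite bracket_iota /bracket (po_wx xp) /signed_act.
  by rewrite (wsgn_tau i j eT) (wabs_tau i j eT) (negPf ji) mul1r subrr mulr0.
rewrite mulr0 sub0r subr0 -mulrN; congr (_ * _).
rewrite (bigD1 j) //= [X in _ + X]big1 ?addr0; last first.
  move=> k /andP[ki kj]; rewrite bracket_sum big1 // => p pT.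
  by rewrite diag_x_far // eq_sym.
rewrite bracket_sum -sumrN; apply: eq_bigr => p pT.
by rewrite bracket_sign off_diag_x.
Qed.

Lemma off_comm_x_far i j k : i != j -> k != i -> k != j ->
  bracket (off_comm iota c e w u i j) (x k) = 0.
Proof.
move=> ij ki kj; rewrite /off_comm bracket_iota bracket_sum big1 ?mulr0 // => p pT.
by rewrite bracket_sign off_x_far ?mulr0.
Qed.

(** The Jacobi identity for y_i, x_j and x_k. If i, j, k are distinct,
both sides vanish, and if j = k they are the same. If k = i and j differs from
it, only the reflections in i and j contribute on either side, and they agree
term by term; the case j = i is symmetric. *)
Lemma yx_comm_x i j k :
  bracket (yx_comm iota c e w t u v i j) (x k) =
  bracket (yx_comm iota c e w t u v i k) (x j).
Proof.
rewrite /yx_comm; case: (eqVneq i j) => [<-|ij]; case: (eqVneq i k) => [<-|ik] //.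
- by rewrite -off_diag_comm_x.
- by rewrite off_diag_comm_x.
case: (eqVneq j k) => [->|jk] //.
by rewrite !off_comm_x_far // eq_sym.
Qed.

End FirstJacobi.

(** Exchanging the c's with the e's and [t] with [- t] transposes the
commutators. *)
Lemma yx_comm_swap (c e : 'I_n -> A) (w : weyl n T -> A) (t u v : K) i j :
  cliff_weyl c e w ->
  yx_comm iota e c w (- t) u v i j = yx_comm iota c e w t u v j i.
Proof.
move=> cw.
rewrite /yx_comm eq_sym; case: (eqVneq j i) => [->|ji].
  rewrite /diag_comm (cw_ce cw i i) rmorphN mulNr mulrN; congr (_ - _ * _ - _).
  apply: eq_bigr => k ki; apply: eq_bigr => p pT.
  by rewrite /diag_term (refl_factorCA cw).
congr (_ * _); apply: eq_bigr => p pT; congr (_ * _).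
by rewrite /off_term (refl_factorCA cw) (reflwC pT) // eq_sym.
Qed.

(** The Jacobi identity for y_j, y_k and x_i, which is the previous one after
the exchange of c and e. *)
Lemma yx_comm_y (y c e : 'I_n -> A) (w : weyl n T -> A) (t u v : K) i j k :
  cliff_weyl c e w -> polar y e c w ->
  bracket (yx_comm iota c e w t u v j i) (y k) =
  bracket (yx_comm iota c e w t u v k i) (y j).
Proof.
move=> cw yp; rewrite -!(yx_comm_swap t u v _ _ cw).
exact: yx_comm_x (cliff_weyl_sym cw) yp _ _ _.
Qed.

End Jacobi.

(** * The ring of linear endomorphisms *)

Section Lendo.
Variables (K : comNzRingType) (V : lmodType K).

Definition linear_pred : {pred V -> V} := fun f => `[< linear f >].

Fact linear_pred_zmod_closed : zmod_closed linear_pred.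
Proof.
split; first by apply/asboolP => k u v; rewrite scaler0 addr0.
move=> f g /asboolP fl /asboolP gl; apply/asboolP => k u v.
rewrite !fctE fl gl scalerBr opprD !addrA; congr (_ - _).
by rewrite -!addrA; congr (_ + _); rewrite addrC.
Qed.
HB.instance Definition _ :=
  GRing.isZmodClosed.Build (V -> V) linear_pred linear_pred_zmod_closed.

Record lendo := Lendo { lendo_fun :> V -> V; _ : lendo_fun \in linear_pred }.
HB.instance Definition _ := [isSub for lendo_fun].
HB.instance Definition _ := [Choice of lendo by <:].
HB.instance Definition _ := [SubChoice_isSubZmodule of lendo by <:].

Implicit Types f g h : lendo.

Lemma lendo_linear f : linear f. Proof. by case: f => f /= /asboolP. Qed.
HB.instance Definition _ f :=
  GRing.isLinear.Build K V V *:%R (lendo_fun f) (lendo_linear f).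

Definition mk_lendo (f : V -> V) (fl : linear f) : lendo :=
  Lendo (introT (asboolP _) fl).

Lemma lendoP f g : f =1 g -> f = g.
Proof. by move=> fg; apply/val_inj/funext. Qed.

Lemma lendoD f g v : (f + g) v = f v + g v. Proof. by []. Qed.
Lemma lendoB f g v : (f - g) v = f v - g v. Proof. by []. Qed.

Fact id_linear : linear (@idfun V). Proof. by []. Qed.
Fact comp_linear f g : linear (f \o g).
Proof. by move=> k u v; rewrite /= !linearP. Qed.

Definition lendo_one : lendo := mk_lendo id_linear.
Definition lendo_mul f g : lendo := mk_lendo (comp_linear f g).

Fact lendo_mulA : associative lendo_mul.
Proof. by move=> f g h; apply: lendoP. Qed.
Fact lendo_mul1 : left_id lendo_one lendo_mul.
Proof. by move=> f; apply: lendoP. Qed.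
Fact lendo_mulr1 : right_id lendo_one lendo_mul.
Proof. by move=> f; apply: lendoP. Qed.
Fact lendo_mulDl : left_distributive lendo_mul +%R.
Proof. by move=> f g h; apply: lendoP. Qed.
Fact lendo_mulDr : right_distributive lendo_mul +%R.
Proof. by move=> f g h; apply: lendoP => v; rewrite /= linearD. Qed.

HB.instance Definition _ := GRing.Zmodule_isPzRing.Build lendo
  lendo_mulA lendo_mul1 lendo_mulr1 lendo_mulDl lendo_mulDr.

Lemma lendo1 v : (1 : lendo) v = v. Proof. by []. Qed.
Lemma lendoM f g v : (f * g) v = f (g v). Proof. by []. Qed.
Lemma lendo_sign (p : bool) f v : ((-1) ^+ p * f) v = (-1) ^+ p *: f v.
Proof. by case: p; rewrite ?mulN1r ?scaleN1r ?mul1r ?scale1r. Qed.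

Fact scale_linear k : linear ( *:%R k : V -> V).
Proof. by move=> l u v; rewrite scalerDr !scalerA mulrC. Qed.
Definition lendo_scale k : lendo := mk_lendo (scale_linear k).

Fact lendo_scale_is_zmod_morphism : zmod_morphism lendo_scale.
Proof. by move=> k l; apply: lendoP => v; rewrite lendoB /= scalerBl. Qed.
Fact lendo_scale_is_monoid_morphism : monoid_morphism lendo_scale.
Proof.
split; first by apply: lendoP => v; rewrite /= scale1r.
by move=> k l; apply: lendoP => v; rewrite /= scalerA.
Qed.
HB.instance Definition _ :=
  GRing.isZmodMorphism.Build K lendo lendo_scale lendo_scale_is_zmod_morphism.
HB.instance Definition _ :=
  GRing.isMonoidMorphism.Build K lendo lendo_scale lendo_scale_is_monoid_morphism.

Lemma lendo_scaleC k f : lendo_scale k * f = f * lendo_scale k.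
Proof. by apply: lendoP => v; rewrite /= linearZ. Qed.

End Lendo.

(** * Coinduction along polynomial variables *)

(** In a module of functions, seen as functionals on a module with a monomial
basis, a generator that maps basis elements to multiples of basis elements acts
by such a weighted substitution. Their products are computed pointwise
([substM]), which reduces relations between operators to relations between
weights and between substitutions. *)
Section Subst.
Variables (K : comNzRingType) (V : lmodType K) (I : Type).
Implicit Types (f g : I -> lendo V) (s r : I -> I).

Fact subst_linear f s : linear (fun (phi : I -> V) i => f i (phi (s i))).
Proof. by move=> k u v; apply/funext => i; rewrite !fctE linearP. Qed.

Definition subst f s : lendo (I -> V) := mk_lendo (subst_linear f s).

Lemma substE f s phi i : subst f s phi i = f i (phi (s i)). Proof. by []. Qed.

Lemma eq_subst f g s r : f =1 g -> s =1 r -> subst f s = subst g r.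
Proof. by move=> /funext-> /funext->. Qed.

Lemma substM f g s r :
  subst f s * subst g r = subst (fun i => f i * g (s i)) (r \o s).
Proof. by apply: lendoP. Qed.

Lemma subst1 : subst (fun=> 1) id = 1.
Proof. by apply: lendoP. Qed.

Lemma substN f s : - subst f s = subst (fun i => - f i) s.
Proof. by apply: lendoP. Qed.

Lemma subst_sign (p : bool) f s :
  (-1) ^+ p * subst f s = subst (fun i => (-1) ^+ p * f i) s.
Proof.
by case: p; rewrite ?mulN1r ?mul1r ?substN; apply: eq_subst => // i;
  rewrite ?mulN1r ?mul1r.
Qed.

End Subst.

(** A function [phi] on exponents stands for the map on the algebra generated by
V's operators and new variables y_i that sends y^b to [phi b] and commutes with
the operators of V. An element a acts by (a phi)(z) = phi(z a). The weights come
from moving a to the left through y^b: e_i y^b is y^b e_i up to the sign of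
b_i, and y^b w_g is w_g times the monomial [mnm_act g b], up to the sign
[mnm_sgn g b]. *)
Section PolyLayer.
Variables (T : weyl_type) (n : nat) (K : comNzRingType) (V : lmodType K).
Variables (c e : 'I_n -> lendo V) (w : weyl n T -> lendo V).
Hypothesis cw : cliff_weyl c e w.
Local Notation M := ('X_{1..n} -> V).
Implicit Types (i j k : 'I_n) (g h : weyl n T) (b : 'X_{1..n}).

Definition poly_c i : lendo M := subst (fun=> c i) id.
Definition poly_e i : lendo M := subst (fun b => (-1) ^+ odd (b i) * e i) id.
Definition poly_y i : lendo M := subst (fun=> 1) (fun b => b + U_(i))%MM.

Definition mnm_act g b : 'X_{1..n} := [multinom b (wabs g k) | k < n].
Definition mnm_sgn g b : bool := \big[addb/false]_k (wsgn g k && odd (b (wabs g k))).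
Definition poly_w g : lendo M :=
  subst (fun b => (-1) ^+ mnm_sgn g b * w g) (mnm_act g).

Lemma poly_cliff_weyl : cliff_weyl poly_c poly_e poly_w.
Proof.
split.
- move=> _ _ [i|i|i j ij|i j ij|i j]; rewrite !substM ?substN -?subst1;
    apply: eq_subst => // b.
  + exact: cw_c2 cw _.
  + by rewrite signMM addbb mul1r (cw_e2 cw).
  + exact: cw_cc cw _ _ ij.
  + by rewrite !signMM (cw_ee cw ij) mulrN addbC.
  + by rewrite signCA (cw_ce cw) -mulrA mulrN.
- rewrite -subst1; apply: eq_subst => b.
    rewrite (cw_1 cw) mulr1 /mnm_sgn big1 ?expr0 // => k _.
    by rewrite wsgn1.
  by apply/mnmP => k; rewrite mnmE wabs1.
- move=> g h; rewrite substM; apply: eq_subst => b; last first.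
    by apply/mnmP => k; rewrite !mnmE wabsM.
  rewrite signMM (cw_M cw); congr ((-1) ^+ nat_of_bool _ * _).
  rewrite /mnm_sgn (reindex (wabs h)) /=; last exact/onW_bij/wabs_bij.
  rewrite -big_split; apply: eq_bigr => k _ /=.
  by rewrite mnmE wsgnM wabsM; case: (wsgn g _); case: (wsgn h _); case: odd.
- move=> g i; rewrite /signed_act subst_sign !substM; apply: eq_subst => b //=.
  by rewrite -mulrA (cw_c cw) signCA /signed_act -!mulrA.
- move=> g i; rewrite /signed_act subst_sign !substM; apply: eq_subst => b //=.
  rewrite mnmE !signMM (cw_e cw) /signed_act -mulrA ![(-1) ^+ _ * (_ * _)]mulrA.
  rewrite -!signr_addb -[RHS]mulrA; congr ((-1) ^+ nat_of_bool _ * _).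
  by case: (wsgn g i); case: (mnm_sgn g b); case: odd.
Qed.

Lemma poly_yC i j : poly_y i * poly_y j = poly_y j * poly_y i.
Proof.
rewrite !substM; apply: eq_subst => // b /=.
by rewrite -!addmA (addmC U_(i)%MM).
Qed.

Lemma poly_polar : polar poly_y poly_e poly_c poly_w.
Proof.
split.
- move=> i j; rewrite !substM subst_sign; apply: eq_subst => // b /=.
  by rewrite mulr1 mul1r mnmDE mnm1E oddD oddb eq_sym addbC signr_addb -mulrA signK.
- by move=> i j; rewrite !substM; apply: eq_subst => // b /=; rewrite mulr1 mul1r.
- move=> g i; rewrite /signed_act subst_sign !substM; apply: eq_subst => b /=.
    rewrite mulr1 mulr1 mulrA -signr_addb; congr (_ ^+ nat_of_bool _ * _).
    rewrite /mnm_sgn (bigD1 i) //= [in RHS](bigD1 i) //= mnmDE mnm1E eqxx oddD addbT.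
    rewrite [in RHS](eq_bigr (fun k => wsgn g k && odd (b (wabs g k)))) => [|k ki].
      by case: (wsgn g i); case: odd => //=; case: (\big[_/_]_(_ | _) _).
    by rewrite mnmDE mnm1E (inj_eq (@wabs_inj _ _ g)) eq_sym (negPf ki) addn0.
  by apply/mnmP => k; rewrite !mnmE (inj_eq (@wabs_inj _ _ g)).
Qed.

End PolyLayer.

(** * The Clifford and Weyl layers *)

Section CliffordLayer.
Variables (K : comNzRingType) (m : nat).
Local Notation M := (('I_m -> bool) -> K^o).
Implicit Types (i j k l : 'I_m) (eta : 'I_m -> bool).

Definition flip_bit k eta : 'I_m -> bool := fun l => eta l (+) (l == k).
(** The number, modulo 2, of generators that the k-th one passes when it is
multiplied from the right into the ordered product described by [eta]. *)
Definition above_parity k eta : bool := \big[addb/false]_(l < m | (k < l)%N) eta l.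
Definition clifford_gen k : lendo M :=
  subst (fun eta => (-1) ^+ above_parity k eta) (flip_bit k).

Lemma above_parity_flip k l eta :
  above_parity l (flip_bit k eta) = above_parity l eta (+) (l < k)%N.
Proof.
rewrite /above_parity big_split /=; congr (_ (+) _).
case: (boolP (l < k)%N) => lk; last first.
  by rewrite big1 // => i li; apply: contraNF lk => /eqP <-.
by rewrite (bigD1 k) //= eqxx big1 // => i /andP[_ /negPf].
Qed.

Lemma clifford_gen2 k : clifford_gen k * clifford_gen k = 1.
Proof.
rewrite substM -subst1; apply: eq_subst => eta.
  by rewrite above_parity_flip ltnn addbF -signr_addb addbb.
by apply/funext => l; rewrite /= /flip_bit -addbA addbb addbF.
Qed.

Lemma clifford_gen_anti k l : k != l ->
  clifford_gen k * clifford_gen l = - (clifford_gen l * clifford_gen k).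
Proof.
move=> kl; rewrite !substM substN; apply: eq_subst => eta; last first.
  by apply/funext => i; rewrite /= /flip_bit addbAC.
rewrite !above_parity_flip -!signr_addb.
have -> : (l < k)%N = ~~ (k < l)%N.
  by rewrite -leqNgt [RHS]leq_eqVlt -[_ == _ :> nat]/(l == k) eq_sym (negPf kl).
rewrite -signrN; congr ((-1) ^+ nat_of_bool _).
by case: (above_parity k _); case: (above_parity l _); case: (_ < _)%N.
Qed.

End CliffordLayer.

(** Coinduction along the group: [phi h] stands for the value at w_h, and
w_h c_i is the image of c_i under h, times w_h. *)
Section WeylLayer.
Variables (T : weyl_type) (n : nat) (K : comNzRingType) (V : lmodType K).
Variables (c e : 'I_n -> lendo V).
Hypothesis cliff : forall a b, clifford_rel c e a b -> a = b.
Local Notation W := (weyl n T).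
Local Notation M := (W -> V).

Definition weyl_lift (a : 'I_n -> lendo V) i : lendo M :=
  subst (fun h => signed_act a h i) id.
Definition weyl_w (g : W) : lendo M := subst (fun=> 1) (fun h => (g * h)%g).

Let weyl_lift_w a g i :
  weyl_w g * weyl_lift a i = signed_act (weyl_lift a) g i * weyl_w g.
Proof.
rewrite /signed_act subst_sign !substM; apply: eq_subst => // h /=.
rewrite mulr1 mul1r /signed_act wsgnM wabsM mulrA -signr_addb.
by rewrite addbC.
Qed.

Lemma weyl_cliff_weyl : cliff_weyl (weyl_lift c) (weyl_lift e) weyl_w.
Proof.
have c2 i : c i * c i = 1 by exact/cliff/clifford_c2.
have e2 i : e i * e i = 1 by exact/cliff/clifford_e2.
have cc i j (ij : i != j) : c i * c j = - (c j * c i) by exact/cliff/clifford_cc.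
have ee i j (ij : i != j) : e i * e j = - (e j * e i) by exact/cliff/clifford_ee.
have ce i j : c i * e j = - (e j * c i) by exact/cliff/clifford_ce.
split; last 2 first.
- exact: weyl_lift_w.
- exact: weyl_lift_w.
- move=> _ _ [i|i|i j ij|i j ij|i j]; rewrite !substM ?substN -?subst1;
    apply: eq_subst => // h; rewrite /signed_act !signMM.
  + by rewrite addbb mul1r c2.
  + by rewrite addbb mul1r e2.
  + by rewrite cc ?mulrN 1?addbC // (inj_eq (@wabs_inj _ _ h)).
  + by rewrite ee ?mulrN 1?addbC // (inj_eq (@wabs_inj _ _ h)).
  + by rewrite ce mulrN addbC.
- by rewrite -subst1; apply: eq_subst => // h; rewrite mul1g.
- by move=> g h; rewrite substM; apply: eq_subst => k; rewrite ?mul1r //= mulgA.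
Qed.

End WeylLayer.

(** * The deformed action of the [x_i] *)

Section Deformed.
Variables (T : weyl_type) (n : nat) (K : comNzRingType) (V : lmodType K).
Variables (x c e : 'I_n -> lendo V) (w : weyl n T -> lendo V) (t u v : K).
Hypotheses (cw : cliff_weyl c e w) (xp : polar x c e w).
Hypothesis xC : forall i j, x i * x j = x j * x i.
Local Notation M := ('X_{1..n} -> V).
Implicit Types (i j k : 'I_n) (g h : weyl n T) (b : 'X_{1..n}) (phi : M).

Let Y i : lendo M := poly_y V i.
Let C := poly_c (n := n) c.
Let E := poly_e e.
Let S := poly_w w.
Let CW : cliff_weyl C E S := poly_cliff_weyl cw.
Let YP : polar Y E C S := poly_polar c e w.
Let H i j : lendo M := yx_comm (@lendo_scale K M) C E S t u v i j.
Let scaleC := @lendo_scaleC K M.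

(** [dunkl j phi] is the value of phi at y^b x_j, obtained by moving x_j to the
left through the factors y_i of y^b one at a time; each step leaves behind the
commutator of y_i and x_j. The natural number [d] is the degree of [b]. *)
Fixpoint dunkl_rec (d : nat) j phi b : V :=
  if d is d'.+1 then
    if [pick i | b i != 0%N] is Some i then
      dunkl_rec d' j (Y i phi) (b - U_(i))%MM + H i j phi (b - U_(i))%MM
    else x j (phi b)
  else x j (phi b).

Lemma dunkl_rec_linear d j b : linear (fun phi => dunkl_rec d j phi b).
Proof.
elim: d b => [|d IHd] b z phi psi /=; first by rewrite !fctE linearP.
case: pickP => [i _|_]; last by rewrite !fctE linearP.
by rewrite !linearP /= IHd scalerDr addrACA.
Qed.

Fact dunkl_linear j : linear (fun phi b => dunkl_rec (mdeg b) j phi b).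
Proof. by move=> z phi psi; apply/funext => b; rewrite dunkl_rec_linear. Qed.

Definition dunkl j : lendo M := mk_lendo (dunkl_linear j).

Lemma dunkl0 j phi : dunkl j phi 0%MM = x j (phi 0%MM).
Proof. by rewrite /= mdeg0. Qed.

Let H_y i j k : H i j * Y k - Y k * H i j = H k j * Y i - Y i * H k j.
Proof. exact: (yx_comm_y scaleC t u v j i k CW YP). Qed.

Let Y_at i phi b : Y i phi b = phi (b + U_(i))%MM. Proof. by []. Qed.

Let dunkl_recE d j phi b : dunkl_rec d.+1 j phi b =
  if [pick i | b i != 0%N] is Some i then
    dunkl_rec d j (Y i phi) (b - U_(i))%MM + H i j phi (b - U_(i))%MM
  else x j (phi b).
Proof. by []. Qed.

Let dunkl_recS d i j phi b : mdeg b = d ->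
  dunkl_rec d.+1 j phi (b + U_(i))%MM =
  dunkl_rec d j (Y i phi) b + H i j phi b.
Proof.
elim: d i phi b => [|d IHd] i phi b db; rewrite [LHS]dunkl_recE;
    (case: pickP => [k bk|/(_ i)]; last by rewrite mnmDE mnm1E eqxx addn1);
    case: (eqVneq k i) => [->|ki]; rewrite ?addmK //.
all: have {}bk : b k != 0%N by move: bk; rewrite mnmDE mnm1E (eq_sym i k) (negPf ki) addn0.
  by move: bk; move/eqP: db; rewrite mdeg_eq0 => /eqP->; rewrite mnm0E.
have [b' bE] : exists b', b = (b' + U_(k))%MM.
  by exists (b - U_(k))%MM; rewrite submK // lep1mP.
have db' : mdeg b' = d by apply/eqP; rewrite -eqSS -db bE mdegD mdeg1 addn1.
have -> : (b + U_(i) - U_(k))%MM = (b' + U_(i))%MM.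
  by rewrite bE -addmA (addmC U_(k)%MM) addmA addmK.
rewrite IHd // [in RHS]bE IHd //.
rewrite -!addrA; congr (_ + _).
  by rewrite -!lendoM (poly_yC V i k).
have := congr1 (fun L : lendo M => L phi b') (H_y i j k).
rewrite !lendoB !fctE !lendoM !Y_at => /eqP.
by rewrite subr_eq addrAC eq_sym subr_eq => /eqP; rewrite addrC.
Qed.

(** The recursion extracts one particular factor of y^b; by the Jacobi identity
for two y's and one x every other factor gives the same result. *)
Lemma dunklS i j phi b :
  dunkl j phi (b + U_(i))%MM = dunkl j (Y i phi) b + H i j phi b.
Proof. by rewrite /= -dunkl_recS // mdegD mdeg1 addn1. Qed.

Lemma y_dunkl i j : Y i * dunkl j = dunkl j * Y i + H i j.
Proof.
apply: lendoP => phi; apply/funext => b.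
by rewrite lendoD !lendoM fctE -dunklS /Y /poly_y substE lendo1.
Qed.

(** An operator that vanishes at the origin and can be moved past every [Y i]
is zero, since [Y i] shifts the argument by the [i]-th unit vector. *)
Lemma lendo_eq0 (D : lendo M) : (forall phi, D phi 0%MM = 0) ->
  (forall i, exists Z, Y i * D = D * Z) -> D = 0.
Proof.
move=> D0 DY; apply: lendoP => phi; apply/funext => b.
move: {2}(mdeg b) (erefl (mdeg b)) => d; elim: d b phi => [|d IHd] b phi db.
  by move/eqP: db; rewrite mdeg_eq0 => /eqP->.
have [i bi] : exists i, b i != 0%N.
  apply/existsP; apply: contraT => /existsPn b0; move: db.
  by rewrite mdegE big1 // => i _; exact/eqP/negbNE/b0.
have bE : b = ((b - U_(i)) + U_(i))%MM by rewrite submK // lep1mP.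
have [Z YZ] := DY i.
have := congr1 (fun L : lendo M => L phi (b - U_(i))%MM) YZ.
rewrite !lendoM Y_at -bE => ->.
by apply: IHd; apply/eqP; rewrite -eqSS -db -addn1 -(mdeg1 i) -mdegD -bE.
Qed.

Let C_at i phi b : C i phi b = c i (phi b). Proof. by []. Qed.
Let E_at0 i phi : E i phi 0%MM = e i (phi 0%MM).
Proof. by rewrite /E /poly_e substE mnm0E mul1r. Qed.
Let S_at0 g phi : S g phi 0%MM = w g (phi 0%MM).
Proof.
rewrite /S /poly_w substE /mnm_sgn big1 ?mul1r => [|k _]; last by rewrite mnm0E andbF.
by congr (w g (phi _)); apply/mnmP => k; rewrite !mnmE.
Qed.

(** This relation and the next ones hold by [lendo_eq0]: at the origin [dunkl]
is [x], and the commutators that arise when [Y i] passes cancel because they are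
compatible with c, e and w. *)
Lemma dunkl_cx k j : C k * dunkl j = (-1) ^+ (k == j) * (dunkl j * C k).
Proof.
apply/eqP; rewrite -subr_eq0; apply/eqP/lendo_eq0 => [phi|i].
  rewrite lendoB lendo_sign !lendoM !fctE C_at !dunkl0 C_at.
  have := congr1 (fun L : lendo V => L (phi 0%MM)) (po_cx xp k j).
  by rewrite lendo_sign !lendoM => ->; rewrite subrr.
exists (Y i); rewrite mulrBr mulrBl signCA (mulrA (Y i) (C k)) -(po_ex YP).
rewrite -mulrA y_dunkl (mulrA (Y i)) y_dunkl !mulrDr !mulrDl mulrDr.
rewrite -!mulrA -(po_ex YP).
by rewrite (yx_comm_c scaleC t u v CW) opprD addrACA subrr addr0.
Qed.

Lemma dunkl_ex k j : E k * dunkl j = dunkl j * E k.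
Proof.
apply/eqP; rewrite -subr_eq0; apply/eqP/lendo_eq0 => [phi|i].
  rewrite lendoB !lendoM !fctE E_at0 !dunkl0 E_at0.
  have := congr1 (fun L : lendo V => L (phi 0%MM)) (po_ex xp k j).
  by rewrite !lendoM => ->; rewrite subrr.
have YE : Y i * E k = (-1) ^+ (k == i) * (E k * Y i).
  by rewrite (po_cx YP) signK.
exists ((-1) ^+ (k == i) * Y i).
rewrite mulrBr mulrBl !mulrA YE y_dunkl -!mulrA y_dunkl !mulrDr !mulrDl -!mulrA YE.
rewrite (yx_comm_e scaleC t u v CW) signK opprD addrACA subrr addr0.
by rewrite !signCA.
Qed.

Lemma dunkl_wx g j : S g * dunkl j = signed_act dunkl g j * S g.
Proof.
apply/eqP; rewrite -subr_eq0; apply/eqP/lendo_eq0 => [phi|i].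
  rewrite lendoB /signed_act -mulrA lendo_sign !lendoM !fctE S_at0 !dunkl0 S_at0.
  have := congr1 (fun L : lendo V => L (phi 0%MM)) (po_wx xp g j).
  by rewrite /signed_act -mulrA lendo_sign !lendoM => ->; rewrite subrr.
rewrite -(wabsKV g i); move: (wabs _ i) => k.
have YS : Y (wabs g k) * S g = (-1) ^+ wsgn g k * (S g * Y k).
  by rewrite (po_wx YP) /signed_act -mulrA signK.
exists ((-1) ^+ wsgn g k * Y k).
rewrite /signed_act mulrBr mulrBl -[_ * dunkl _ * S g]mulrA (signCA _ (Y _)).
rewrite (mulrA (Y _) (S g)) YS -!mulrA y_dunkl (mulrA (Y _) (dunkl _)) y_dunkl.
rewrite (mulrDl _ _ (S g)) -(mulrA _ (Y _)) YS !mulrDr (yx_comm_w scaleC t u v CW).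
rewrite -/(H _ _) opprD addrACA signr_addb -!mulrA signK subrr addr0.
by rewrite !(signCA _ (dunkl _)) !(signCA _ (S g)) !(signCA _ (dunkl _)).
Qed.

Lemma dunkl_polar : polar dunkl C E S.
Proof. by split; [exact: dunkl_cx|exact: dunkl_ex|exact: dunkl_wx]. Qed.

(** Here the commutators cancel by the Jacobi identity for y_i and two x's. *)
Lemma dunklC j k : dunkl j * dunkl k = dunkl k * dunkl j.
Proof.
apply/eqP; rewrite -subr_eq0; apply/eqP/lendo_eq0 => [phi|i].
  rewrite lendoB !lendoM !fctE !dunkl0.
  have := congr1 (fun L : lendo V => L (phi 0%MM)) (xC j k).
  by rewrite !lendoM => ->; rewrite subrr.
exists (Y i); rewrite mulrBr mulrBl !mulrA !y_dunkl !mulrDl -!mulrA !y_dunkl !mulrDr.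
have := yx_comm_x scaleC t u v CW dunkl_polar i j k; rewrite /bracket -!/(H _ _) => /eqP.
rewrite subr_eq addrAC eq_sym subr_eq => /eqP.
rewrite [in RHS]addrC [in LHS]addrC => ac.
rewrite -(addrA _ (dunkl j * H i k)) -(addrA _ (dunkl k * H i j)) -ac.
by rewrite opprD addrACA subrr addr0.
Qed.

End Deformed.

(** * Realizations of the defining relations *)

Section Realization.
Variables (K : comNzRingType) (T : weyl_type) (n : nat) (A : pzRingType).
Variable iota : {rmorphism K -> A}.
Variables (x y c e : 'I_n -> A) (w : weyl n T -> A) (t u v : K).

Record hcc_realization : Prop := HccRealization {
  re_cw : cliff_weyl c e w;
  re_x : polar x c e w;
  re_y : polar y e c w;
  re_xx : forall i j, x i * x j = x j * x i;
  re_yy : forall i j, y i * y j = y j * y i;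
  re_yx : forall i j, y i * x j = x j * y i + yx_comm iota c e w t u v i j }.

End Realization.

(** The three types differ in two summands, which are present exactly when
[refl_type T true] and [is_typeB T] hold. *)
Lemma match_weyl_off (T : weyl_type) (Z : zmodType) (a b : Z) :
  match T with TypeA => a | TypeB | TypeD => a - b end =
  a - (if refl_type T true then b else 0).
Proof. by case: T; rewrite ?subr0. Qed.

Lemma match_weyl_diag (T : weyl_type) (Z : zmodType) (a b d : Z) :
  match T with TypeA => a | TypeB => a - b - d | TypeD => a - b end =
  a - (if refl_type T true then b else 0) - (if is_typeB T then d else 0).
Proof. by case: T; rewrite ?subr0. Qed.

Lemma rmorph_refl (p : bool) (R S : pzRingType) (f : {rmorphism R -> S})
    (a b a' b' d : R) (sgn := fun z : R => if p then - z else z) :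
  f ((1 + sgn (a * b)) * (1 + sgn (a' * b')) * d) =
  (1 + (-1) ^+ p * (f a * f b)) * ((1 + (-1) ^+ p * (f a' * f b')) * f d).
Proof.
by rewrite /sgn !mulr_sign -mulrA; case: (p);
  rewrite !(rmorphM, rmorphD, rmorphN, rmorph1).
Qed.

Lemma rmorph_sqr1 (R S : pzRingType) (f : {rmorphism R -> S}) a :
  f (a * a) = f 1 <-> f a * f a = 1.
Proof. by rewrite rmorphM rmorph1. Qed.

Lemma rmorph_anti (R S : pzRingType) (f : {rmorphism R -> S}) a b :
  f (a * b) = f (- (b * a)) <-> f a * f b = - (f b * f a).
Proof. by rewrite rmorphN !rmorphM. Qed.

Lemma rmorph_mul2 (R S : pzRingType) (f : {rmorphism R -> S}) a b c d :
  f (a * b) = f (c * d) <-> f a * f b = f c * f d.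
Proof. by rewrite !rmorphM. Qed.

Lemma rmorph_sign_mul2 (R S : pzRingType) (f : {rmorphism R -> S}) (p : bool) a b c d :
  f (a * b) = f ((-1) ^+ p * (c * d)) <-> f a * f b = (-1) ^+ p * (f c * f d).
Proof. by rewrite !rmorphM rmorph_sign. Qed.

Lemma rmorph_bracket (R S : pzRingType) (f : {rmorphism R -> S}) a b d :
  f (a * b - b * a) = f d <-> f a * f b = f b * f a + f d.
Proof.
rewrite rmorphB !rmorphM; split=> [<-|->]; first by rewrite addrC subrK.
by rewrite addrC addKr.
Qed.

Section Bridge.
Variables (K : comNzRingType) (T : weyl_type) (n : nat) (A : pzRingType).
Variable iota : {rmorphism K -> A}.
Local Notation F := (free_alg K (hcc_gen T n)).
Variable f : {rmorphism F -> A}.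
Hypothesis fZ : forall k a, f (k *: a) = iota k * f a.
Variables (t u v : K).

Local Notation c := (fun i => f (fgen K (gen_c T i))).
Local Notation e := (fun i => f (fgen K (gen_e T i))).
Local Notation w := (fun g => f (fgen K (gen_w g))).

Lemma free_wact (a : 'I_n -> F) g i : f (wact a g i) = signed_act (fun k => f (a k)) g i.
Proof. by rewrite /wact rmorphM rmorph_sign. Qed.

Let termF (i j k l : 'I_n) : F :=
  (1 + fgen K (gen_c T i) * fgen K (gen_c T j)) *
  (1 + fgen K (gen_e T k) * fgen K (gen_e T l)) * fgen K (gen_w (s_ T i j)).

Let termT (i j k l : 'I_n) : F :=
  (1 - fgen K (gen_c T i) * fgen K (gen_c T j)) *
  (1 - fgen K (gen_e T k) * fgen K (gen_e T l)) * fgen K (gen_w (sbar_ T i j)).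

Let f_termF i j k l : f (termF i j k l) =
  refl_factor c false i j *
    (refl_factor e false k l * f (fgen K (gen_w (reflw T false i j)))).
Proof. exact: (rmorph_refl false). Qed.

Let f_termT i j k l : f (termT i j k l) =
  refl_factor c true i j *
    (refl_factor e true k l * f (fgen K (gen_w (reflw T true i j)))).
Proof. exact: (rmorph_refl true). Qed.

Let sum_refl_type (Z : nmodType) (G : bool -> Z) :
  \sum_(p | refl_type T p) G p = G false + (if refl_type T true then G true else 0).
Proof.
rewrite big_mkcond big_bool addrC; congr (_ + _).
by have -> : refl_type T false by case: (T).
Qed.

Lemma free_comm_offdiag i j :
  f (comm_offdiag T u i j) = off_comm iota c e w u i j.
Proof.
transitivity (f (u *: termF i j j i
                 - (if refl_type T true then u *: termT i j j i else 0))).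
  by congr (f _); exact: match_weyl_off.
rewrite rmorphB fZ /off_comm sum_refl_type mulrDr mul1r f_termF; congr (_ + _).
case: ifP => _; first by rewrite fZ f_termT expr1 mulN1r mulrN.
by rewrite raddf0 mulr0 oppr0.
Qed.

Lemma free_comm_diag i :
  f (comm_diag T t u v i) = diag_comm iota c e w t u v i.
Proof.
transitivity (f (t *: (fgen K (gen_c T i) * fgen K (gen_e T i))
   - u *: (\sum_(k < n | k != i) termF k i k i)
   - (if refl_type T true then u *: (\sum_(k < n | k != i) termT k i k i) else 0)
   - (if is_typeB T then v *: fgen K (gen_w (tau_ T i)) else 0))).
  by congr (f _); exact: match_weyl_diag.
rewrite rmorphB /diag_comm; congr (_ - _); last first.
  by rewrite /tau_term; case: ifP => _; [rewrite fZ | rewrite raddf0].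
rewrite 2!rmorphB -addrA -opprD; congr (_ - _).
  exact: etrans (fZ _ _) (congr1 ( *%R _) (rmorphM _ _ _)).
rewrite fZ [in RHS](eq_bigr _ (fun k _ => sum_refl_type _)) big_split mulrDr raddf_sum.
congr (_ * _ + _).
  by apply: eq_bigr => k _; exact: f_termF.
case: ifP => _; last by rewrite raddf0 big1 ?mulr0.
by rewrite fZ raddf_sum; congr (_ * _); apply: eq_bigr => k _; exact: f_termT.
Qed.

(** Maps out of the free algebra that respect the presentation are the same as
realizations; this direction is used for the model, the other one for the
presented algebra itself. *)
Lemma realization_rel :
  hcc_realization iota (fun i => f (fgen K (gen_x T i)))
    (fun i => f (fgen K (gen_y T i))) c e w t u v ->
  forall a b, hcc_rel t u v a b -> f a = f b.
Proof.
move=> re a b; case=> {a b}.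
- by rewrite (cw_1 (re_cw re)) rmorph1.
- by move=> g h; rewrite rmorphM (cw_M (re_cw re)).
- move=> a b; have h := cw_clifford (re_cw re).
  case=> [i|i|i j ij|i j ij|i j].
  + by apply/rmorph_sqr1/h/clifford_c2.
  + by apply/rmorph_sqr1/h/clifford_e2.
  + by apply/rmorph_anti/h/clifford_cc.
  + by apply/rmorph_anti/h/clifford_ee.
  + by apply/rmorph_anti/h/clifford_ce.
- by move=> i j; apply/rmorph_mul2; exact: re_xx re _ _.
- by move=> i j; apply/rmorph_mul2; exact: re_yy re _ _.
- by move=> g i; apply/rmorph_mul2; rewrite free_wact; exact: cw_c (re_cw re) _ _.
- by move=> g i; apply/rmorph_mul2; rewrite free_wact; exact: cw_e (re_cw re) _ _.
- by move=> g i; apply/rmorph_mul2; rewrite free_wact; exact: po_wx (re_x re) _ _.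
- by move=> g i; apply/rmorph_mul2; rewrite free_wact; exact: po_wx (re_y re) _ _.
- by move=> i j; apply/rmorph_mul2; exact: po_ex (re_x re) _ _.
- by move=> i j; apply/rmorph_sign_mul2; exact: po_cx (re_x re) _ _.
- by move=> i j; apply/rmorph_mul2; exact: po_ex (re_y re) _ _.
- by move=> i j; apply/rmorph_sign_mul2; exact: po_cx (re_y re) _ _.
- move=> i j ij; apply/rmorph_bracket; rewrite free_comm_offdiag.
  by have := re_yx re i j; rewrite /yx_comm (negPf ij).
- move=> i; apply/rmorph_bracket; rewrite free_comm_diag.
  by have := re_yx re i i; rewrite /yx_comm eqxx.
Qed.

Lemma rel_realization :
  (forall a b, hcc_rel t u v a b -> f a = f b) ->
  hcc_realization iota (fun i => f (fgen K (gen_x T i)))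
    (fun i => f (fgen K (gen_y T i))) c e w t u v.
Proof.
move=> h; split.
- split.
  + move=> a b [i|i|i j ij|i j ij|i j].
    * exact/rmorph_sqr1/h/hcc_clifford/clifford_c2.
    * exact/rmorph_sqr1/h/hcc_clifford/clifford_e2.
    * exact/rmorph_anti/h/hcc_clifford/clifford_cc.
    * exact/rmorph_anti/h/hcc_clifford/clifford_ee.
    * exact/rmorph_anti/h/hcc_clifford/clifford_ce.
  + by rewrite (h _ _ (hcc_w1 T n t u v)); exact: rmorph1.
  + by move=> g g'; rewrite -(h _ _ (hcc_wM t u v g g')); exact/esym/rmorphM.
  + by move=> g i; rewrite -free_wact; exact/rmorph_mul2/h/hcc_wc.
  + by move=> g i; rewrite -free_wact; exact/rmorph_mul2/h/hcc_we.
- split.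
  + by move=> i j; exact/rmorph_sign_mul2/h/hcc_cx.
  + by move=> i j; exact/rmorph_mul2/h/hcc_ex.
  + by move=> g i; rewrite -free_wact; exact/rmorph_mul2/h/hcc_wx.
- split.
  + by move=> i j; exact/rmorph_sign_mul2/h/hcc_ey.
  + by move=> i j; exact/rmorph_mul2/h/hcc_cy.
  + by move=> g i; rewrite -free_wact; exact/rmorph_mul2/h/hcc_wy.
- by move=> i j; exact/rmorph_mul2/h/hcc_xx.
- by move=> i j; exact/rmorph_mul2/h/hcc_yy.
- move=> i j; rewrite /yx_comm; case: (eqVneq i j) => [<-|ij].
    by rewrite -free_comm_diag; exact/rmorph_bracket/h/hcc_yxd.
  by rewrite -free_comm_offdiag; exact/rmorph_bracket/h/hcc_yx.
Qed.

End Bridge.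

Section PresScalar.
Variables (K : comNzRingType) (X : choiceType).
Variable (r : free_alg K X -> free_alg K X -> Prop).

Definition pres_scalar (k : K) : pres r := k *: (1 : pres r).

Fact pres_scalar_is_zmod_morphism : zmod_morphism pres_scalar.
Proof. by move=> k l; rewrite /pres_scalar scalerBl. Qed.
Fact pres_scalar_is_monoid_morphism : monoid_morphism pres_scalar.
Proof.
split; first exact: scale1r.
by move=> k l; rewrite /pres_scalar -pres_scaleAl mul1r scalerA.
Qed.
HB.instance Definition _ :=
  GRing.isZmodMorphism.Build K (pres r) pres_scalar pres_scalar_is_zmod_morphism.
HB.instance Definition _ :=
  GRing.isMonoidMorphism.Build K (pres r) pres_scalar pres_scalar_is_monoid_morphism.

Lemma pres_scalarE k a : pres_scalar k * a = k *: a.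
Proof. by rewrite /pres_scalar -pres_scaleAl mul1r. Qed.

Lemma pres_scalarC k a : pres_scalar k * a = a * pres_scalar k.
Proof. by rewrite pres_scalarE /pres_scalar -pres_scaleAr mulr1. Qed.

Definition pres_pi (a : free_alg K X) : pres r := \pi_(pres r) a.

Fact pres_pi_is_zmod_morphism : zmod_morphism pres_pi.
Proof. by move=> a b; rewrite -[- b]scaleN1r -[- pres_pi b]scaleN1r presZ -presD. Qed.
Fact pres_pi_is_monoid_morphism : monoid_morphism pres_pi.
Proof. by split; [exact: erefl | exact: (@presM K X r)]. Qed.
HB.instance Definition _ :=
  GRing.isZmodMorphism.Build (free_alg K X) (pres r) pres_pi pres_pi_is_zmod_morphism.
HB.instance Definition _ :=
  GRing.isMonoidMorphism.Build (free_alg K X) (pres r) pres_pi pres_pi_is_monoid_morphism.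

Lemma pres_piZ k a : pres_pi (k *: a) = pres_scalar k * pres_pi a.
Proof. by rewrite pres_scalarE /pres_pi presZ. Qed.

Lemma pres_pi_rel a b : r a b -> pres_pi a = pres_pi b.
Proof. by move=> ab; apply/presP/ideal_rel. Qed.

End PresScalar.

Section HccRealization.
Variables (K : comNzRingType) (T : weyl_type) (n : nat) (t u v : K).

Lemma hcc_realizes :
  hcc_realization (@pres_scalar K _ (@hcc_rel K T n t u v))
    (hcc_x T t u v) (hcc_y T t u v) (hcc_c T t u v) (hcc_e T t u v)
    (@hcc_w K T n t u v) t u v.
Proof.
apply: (@rel_realization K T n _ _ (@pres_pi K _ (@hcc_rel K T n t u v))).
- exact: pres_piZ.
- exact: pres_pi_rel.
Qed.

End HccRealization.

(** * Linear independence *)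

Lemma eq_realization (K : comNzRingType) (T : weyl_type) (n : nat) (A : pzRingType)
    (iota : {rmorphism K -> A}) (x y c e x' y' c' e' : 'I_n -> A)
    (w w' : weyl n T -> A) (t u v : K) :
  x' = x -> y' = y -> c' = c -> e' = e -> w' = w ->
  hcc_realization iota x y c e w t u v -> hcc_realization iota x' y' c' e' w' t u v.
Proof. by move=> -> -> -> -> ->. Qed.

Section RealizationLift.
Variables (K : comNzRingType) (T : weyl_type) (n : nat) (A : pzRingType).
Variable iota : {rmorphism K -> A}.
Hypothesis iotaC : forall k a, iota k * a = a * iota k.
Variables (x y c e : 'I_n -> A) (w : weyl n T -> A) (t u v : K).
Hypothesis re : hcc_realization iota x y c e w t u v.

Definition gen_image (z : hcc_gen T n) : A :=
  match z with
  | gen_x i => x i | gen_y i => y i | gen_c i => c i | gen_e i => e i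
  | gen_w g => w g
  end.

Let lift_gen (I : Type) (F : I -> hcc_gen T n) :
  (fun i => free_lift iotaC gen_image (fgen K (F i))) = gen_image \o F.
Proof. by apply/funext => i; rewrite free_lift_gen. Qed.

Lemma gen_image_rel a b : hcc_rel t u v a b ->
  free_lift iotaC gen_image a = free_lift iotaC gen_image b.
Proof.
apply: realization_rel => [k d|]; first exact: free_liftZ.
exact: (eq_realization (lift_gen (@gen_x T n)) (lift_gen (@gen_y T n))
  (lift_gen (@gen_c T n)) (lift_gen (@gen_e T n)) (lift_gen (@gen_w T n)) re).
Qed.

End RealizationLift.

Section Model.
Variables (K : comNzRingType) (T : weyl_type) (n : nat) (t u v : K).
Local Notation W := (weyl n T).
Local Notation bits := ('I_(n + n) -> bool).
Local Notation V0 := (bits -> K^o).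
Local Notation V1 := (W -> V0).
Local Notation V2 := ('X_{1..n} -> V1).
Local Notation V3 := ('X_{1..n} -> V2).

(* Four layers of coinduction: Clifford, Weyl group, x and y. The x-layer
exchanges the roles of c and e, because it is c that anticommutes with x. *)
Let c0 i : lendo V0 := clifford_gen K (lshift n i).
Let e0 i : lendo V0 := clifford_gen K (rshift n i).
Let c1 : 'I_n -> lendo V1 := weyl_lift T c0.
Let e1 : 'I_n -> lendo V1 := weyl_lift T e0.
Let w1 : W -> lendo V1 := @weyl_w T n K V0.
Let x2 : 'I_n -> lendo V2 := @poly_y n K V1.
Let c2 : 'I_n -> lendo V2 := poly_e c1.
Let e2 : 'I_n -> lendo V2 := poly_c (n := n) e1.
Let w2 : W -> lendo V2 := poly_w w1.
Definition model_x : 'I_n -> lendo V3 := dunkl x2 c2 e2 w2 t u v.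
Definition model_y : 'I_n -> lendo V3 := @poly_y n K V2.
Definition model_c : 'I_n -> lendo V3 := poly_c (n := n) c2.
Definition model_e : 'I_n -> lendo V3 := poly_e e2.
Definition model_w : W -> lendo V3 := poly_w w2.

Let cliff0 a b : clifford_rel c0 e0 a b -> a = b.
Proof.
case=> [i|i|i j ij|i j ij|i j].
- exact: clifford_gen2.
- exact: clifford_gen2.
- by apply: clifford_gen_anti; rewrite (inj_eq (@lshift_inj _ _)).
- by apply: clifford_gen_anti; rewrite (inj_eq (@rshift_inj _ _)).
- by apply: clifford_gen_anti; rewrite eq_lrshift.
Qed.

Let cw2 : cliff_weyl c2 e2 w2.
Proof.
exact/cliff_weyl_sym/poly_cliff_weyl/cliff_weyl_sym/weyl_cliff_weyl/cliff0.
Qed.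

Let xp2 : polar x2 c2 e2 w2. Proof. exact: poly_polar. Qed.
Let x2C i j : x2 i * x2 j = x2 j * x2 i. Proof. exact: poly_yC. Qed.

Lemma model_realizes : hcc_realization (@lendo_scale K V3)
  model_x model_y model_c model_e model_w t u v.
Proof.
split.
- exact: poly_cliff_weyl cw2.
- exact: dunkl_polar cw2 xp2.
- exact: poly_polar.
- exact: dunklC cw2 xp2 x2C.
- exact: poly_yC.
- exact: y_dunkl cw2.
Qed.

Definition model_act : {rmorphism hcc T n t u v -> lendo V3} :=
  pres_lift (gen_image_rel (@lendo_scaleC K V3) model_realizes).

Definition point : Type := ('X_{1..n} * 'X_{1..n} * W * bits)%type.
Definition eval_at (p : point) (phi : V3) : K :=
  let: (b, a, h, eta) := p in phi b a h eta.

(** Composition with [L] turns evaluations at points into each other, up to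
sign; a point can thus be followed through a product read from left to right. *)
Definition shifts (L : lendo V3) (p q : point) : Prop :=
  exists s : bool, forall phi, eval_at p (L phi) = (-1) ^+ s * eval_at q phi.

Lemma shifts1 p : shifts 1 p p.
Proof. by exists false => phi; rewrite mul1r. Qed.

Lemma shiftsM L L' p q r : shifts L p q -> shifts L' q r -> shifts (L * L') p r.
Proof.
move=> [s Ls] [s' Ls']; exists (s (+) s') => phi.
by rewrite lendoM Ls Ls' mulrA -signr_addb.
Qed.

Lemma shifts_y i b a h eta :
  shifts (model_y i) (b, a, h, eta) ((b + U_(i))%MM, a, h, eta).
Proof. by exists false => phi; rewrite mul1r. Qed.

(** Only at y-exponent 0: elsewhere [dunkl] adds commutators. *)
Lemma shifts_x i a h eta :
  shifts (model_x i) (0%MM, a, h, eta) (0%MM, (a + U_(i))%MM, h, eta).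
Proof. by exists false => phi; rewrite mul1r /eval_at /model_x dunkl0. Qed.

Let weyl_lift_gen_at (k : 'I_n -> 'I_(n + n)) i (psi : V1) h eta :
  weyl_lift T (fun j => clifford_gen K (k j)) i psi h eta =
  (-1) ^+ (wsgn h i (+) above_parity (k (wabs h i)) eta) *
    psi h (flip_bit (k (wabs h i)) eta).
Proof.
rewrite /weyl_lift substE /signed_act lendo_sign signr_addb -mulrA.
rewrite -[LHS]/((-1) ^+ wsgn h i *
  (clifford_gen K (k (wabs h i)) (psi h) eta)) /clifford_gen substE.
by rewrite -[X in lendo_fun X]mulr1 lendo_sign.
Qed.

Lemma shifts_c i b a h eta : shifts (model_c i) (b, a, h, eta)
  (b, a, h, flip_bit (lshift n (wabs h i)) eta).
Proof.
eexists (odd (a i) (+) _) => phi.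
rewrite /eval_at /model_c /poly_c substE /c2 /poly_e substE lendo_sign.
rewrite -[LHS]/((-1) ^+ odd (a i) * (c1 i (phi b a) h eta)) weyl_lift_gen_at.
by rewrite mulrA -signr_addb.
Qed.

Lemma shifts_e i b a h eta : shifts (model_e i) (b, a, h, eta)
  (b, a, h, flip_bit (rshift n (wabs h i)) eta).
Proof.
eexists (odd (b i) (+) _) => phi.
rewrite /eval_at /model_e /poly_e substE lendo_sign.
rewrite -[LHS]/((-1) ^+ odd (b i) * (e1 i (phi b a) h eta)) weyl_lift_gen_at.
by rewrite mulrA -signr_addb.
Qed.

Lemma shifts_w g b a h eta : shifts (model_w g) (b, a, h, eta)
  (mnm_act g b, mnm_act g a, (g * h)%g, eta).
Proof.
exists (mnm_sgn g b (+) mnm_sgn g a) => phi.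
rewrite /eval_at /model_w /poly_w substE lendo_sign.
rewrite -[LHS]/((-1) ^+ mnm_sgn g b *
  ((poly_w w1 g (phi (mnm_act g b)) a h) eta)) /poly_w substE lendo_sign.
by rewrite signr_addb -mulrA.
Qed.

Lemma shifts_mnm (L : 'I_n -> lendo V3) (P : 'X_{1..n} -> point) :
  (forall z i, shifts (L i) (P z) (P (z + U_(i))%MM)) ->
  forall (m : 'I_n -> nat) z,
  shifts (\prod_(i < n) L i ^+ m i) (P z) (P (z + [multinom m i | i < n])%MM).
Proof.
move=> LP m z; rewrite [X in (_ + X)%MM]multinomUE_id.
have LX i k y : shifts (L i ^+ k) (P y) (P (y + U_(i) *+ k)%MM).
  elim: k y => [|k IHk] y; first by rewrite mulm0n addm0; exact: shifts1.
  by rewrite exprS mulmS addmA; apply: shiftsM (IHk _); exact: LP.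
elim: (index_enum _) z => [|i s IHs] z.
  by rewrite !big_nil addm0; exact: shifts1.
by rewrite !big_cons addmA mnmE; exact: shiftsM (LX _ _ _) (IHs _).
Qed.

Lemma shifts_flip (L : 'I_n -> lendo V3) (P : ('I_n -> bool) -> point) :
  (forall z i, shifts (L i) (P z) (P (flip_bit i z))) ->
  forall (eps : 'I_n -> bool),
  shifts (\prod_(i < n) L i ^+ (eps i : nat)) (P (fun=> false)) (P eps).
Proof.
move=> LP eps.
have Ps s z : shifts (\prod_(i <- s) L i ^+ (eps i : nat)) (P z)
    (P (fun k => z k (+) \big[addb/false]_(i <- s) (eps i && (k == i)))).
  elim: s z => [|i s IHs] z.
    rewrite big_nil; set z' := (fun=> _); suff -> : z' = z by exact: shifts1.
    by apply/funext => k; rewrite /z' big_nil addbF.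
  have -> : (fun k => z k (+) \big[addb/false]_(j <- i :: s) (eps j && (k == j))) =
      (fun k => (if eps i then flip_bit i z else z) k (+)
        \big[addb/false]_(j <- s) (eps j && (k == j))).
    apply/funext => k; rewrite big_cons addbA; congr (_ (+) _).
    by case: (eps i) => //=; rewrite addbF.
  rewrite big_cons.
  apply: shiftsM (IHs _); case: (eps i); first exact: LP.
  exact: shifts1.
have := Ps (index_enum _) (fun=> false); set z := (X in P X); move: @z.
set z := (X in P X); suff -> : z = eps by [].
apply/funext => k; rewrite /z (bigD1 k) //= eqxx andbT big1 ?addbF // => i ik.
by rewrite eq_sym (negPf ik) andbF.
Qed.

(** The state reached from the origin: [eps] on the [c]-half, and [eps']
moved by [g] on the [e]-half. *)
Definition bits_of (g : W) (eps eps' : 'I_n -> bool) : bits :=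
  fun l => match fintype.split l with
           | inl i => eps i
           | inr i => eps' (wabs g^-1%g i)
           end.

Let bits_ofL g eps eps' i : bits_of g eps eps' (lshift n i) = eps i.
Proof. by rewrite /bits_of (unsplitK (inl i)). Qed.

Let bits_ofR g eps eps' i :
  bits_of g eps eps' (rshift n i) = eps' (wabs g^-1%g i).
Proof. by rewrite /bits_of (unsplitK (inr i)). Qed.

Let bits_eq (eta eta' : bits) : eta \o lshift n =1 eta' \o lshift n ->
  eta \o @rshift n n =1 eta' \o @rshift n n -> eta = eta'.
Proof.
move=> el er; apply/funext => l; rewrite -[l]splitK.
by case: (fintype.split l) => k; [exact: el | exact: er].
Qed.

Let bits_of_c g eps eps' i :
  flip_bit (lshift n i) (bits_of g eps eps') = bits_of g (flip_bit i eps) eps'.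
Proof.
apply: bits_eq => k; rewrite /= /flip_bit ?bits_ofL ?bits_ofR.
  by rewrite (inj_eq (@lshift_inj _ _)).
by rewrite eq_rlshift addbF.
Qed.

Let bits_of_e g eps eps' i :
  flip_bit (rshift n (wabs g i)) (bits_of g eps eps') = bits_of g eps (flip_bit i eps').
Proof.
apply: bits_eq => k; rewrite /= /flip_bit ?bits_ofL ?bits_ofR.
  by rewrite eq_lrshift addbF.
by rewrite (inj_eq (@rshift_inj _ _)) -(inj_eq (@wabs_inj _ _ g) _ i) wabsKV.
Qed.

Let bits_of0 g : bits_of g (fun=> false) (fun=> false) = fun=> false.
Proof. by apply: bits_eq => k /=; rewrite ?bits_ofL ?bits_ofR. Qed.

Definition index_point (p : hcc_index T n) : point :=
  let: (a, eps, g, eps', b) := p in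
  ([multinom b i | i < n], mnm_act g [multinom a i | i < n], g, bits_of g eps eps').

Lemma index_point_inj : injective index_point.
Proof.
move=> [[[[a eps] g] eps'] b] [[[[a1 eps1] g1] eps1'] b1] eq.
have /= eb := congr1 (fun p : point => p.1.1.1) eq.
have /= ea := congr1 (fun p : point => p.1.1.2) eq.
have /= eg := congr1 (fun p : point => p.1.2) eq.
have /= ee := congr1 (fun p : point => p.2) eq.
subst g1; congr (_, _, _, _, _); apply/ffunP => i.
- move/mnmP: ea => /(_ (wabs g^-1%g i)).
  by rewrite !mnmE wabsKV.
- by have := congr1 (@^~ (lshift n i)) ee; rewrite !bits_ofL.
- have := congr1 (@^~ (rshift n (wabs g i))) ee; rewrite !bits_ofR.
  by rewrite -wabsM mulgV wabs1.
- by move/mnmP: eb => /(_ i); rewrite !mnmE.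
Qed.

(** Read from left to right, the factors of a basis element move the origin
step by step: x^a sets the second exponent, c^eps the first bits, w the group
element while it permutes the second exponent, e^eps' the last bits, and y^b the
first exponent. The x's act first, where they are plain shifts. *)
Lemma basis_shifts p :
  shifts (model_act (hcc_basis t u v p)) (0%MM, 0%MM, 1%g, fun=> false)
    (index_point p).
Proof.
have actM (L : 'I_n -> hcc T n t u v) (m : 'I_n -> nat) :
    model_act (monomial L m) = \prod_(i < n) model_act (L i) ^+ m i.
  by rewrite /monomial rmorph_prod; apply: eq_bigr => i _; rewrite rmorphXn.
case: p => [[[[a eps] g] eps'] b]; rewrite /hcc_basis !rmorphM !actM /index_point.
set B := mnm_act g _; pose A := [multinom a i | i < n].
have act0 : mnm_act g 0%MM = 0%MM by apply/mnmP => k; rewrite !mnmE.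
apply: (@shiftsM _ _ _ (0%MM, B, g, bits_of g eps eps')); last first.
  under eq_bigr => i _ do rewrite pres_lift_gen.
  have := @shifts_mnm model_y (fun z => (z, B, g, bits_of g eps eps'))
    (fun z i => shifts_y i z _ _ _) b 0%MM.
  by rewrite add0m.
apply: (@shiftsM _ _ _ (0%MM, B, g, bits_of g eps (fun=> false))); last first.
  under eq_bigr => i _ do rewrite pres_lift_gen.
  apply: (shifts_flip (P := fun z => (_, _, g, bits_of g eps z))) => z i.
  by rewrite -bits_of_e; exact: shifts_e.
have -> : bits_of g eps (fun=> false) = bits_of 1%g eps (fun=> false).
  by apply: bits_eq => k /=; rewrite ?bits_ofL ?bits_ofR.
apply: (@shiftsM _ _ _ (0%MM, A, 1%g, bits_of 1%g eps (fun=> false))); last first.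
  rewrite pres_lift_gen -[X in shifts _ _ (X, _, _, _)]act0.
  rewrite -[X in shifts _ _ (_, _, X, _)]mulg1; exact: shifts_w.
apply: (@shiftsM _ _ _ (0%MM, A, 1%g, fun=> false)); last first.
  under eq_bigr => i _ do rewrite pres_lift_gen.
  rewrite -[X in shifts _ (_, _, _, X) _](bits_of0 1%g).
  apply: (shifts_flip (P := fun z => (_, _, _, bits_of 1%g z (fun=> false)))) => z i.
  by rewrite -bits_of_c -[X in lshift n X](wabs1 T); exact: shifts_c.
under eq_bigr => i _ do rewrite pres_lift_gen.
have := @shifts_mnm model_x (fun z => (0%MM, z, 1%g, fun=> false))
  (fun z i => shifts_x i z _ _) a 0%MM.
by rewrite add0m.
Qed.

Let eval_sum (I : Type) (s : seq I) (L : I -> lendo V3) p phi :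
  eval_at p ((\sum_(i <- s) L i) phi) = \sum_(i <- s) eval_at p (L i phi).
Proof.
have evalD f g : eval_at p (f + g) = eval_at p f + eval_at p g.
  by case: p => [[[b a] h] eta].
elim: s => [|i s IHs]; first by rewrite !big_nil; case: p {evalD} => [[[b a] h] eta].
by rewrite [in LHS]big_cons big_cons lendoD evalD IHs.
Qed.

Let eval_pt p q (phi := fun b a h eta => (((b, a, h, eta) : point) == q)%:R : K^o) :
  eval_at p phi = (p == q)%:R.
Proof. by case: p => [[[b a] h] eta]. Qed.

(** Different basis elements move the origin to different points; so applying a
linear relation to the indicator function of the point of one of them, and
evaluating at the origin, isolates the coefficient of that element. *)
Theorem hcc_basis_lin_indep : lin_indep (@hcc_basis K T n t u v).
Proof.
move=> s k us sum0 p0 sp0; pose q := index_point p0.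
pose phi : V3 := fun b a h eta => (((b, a, h, eta) : point) == q)%:R.
have := congr1 (fun z => eval_at (0%MM, 0%MM, 1%g, fun=> false) (model_act z phi)) sum0.
rewrite raddf_sum raddf0 eval_sum -[RHS]/(0 : K).
have term i : eval_at (0%MM, 0%MM, 1%g, fun=> false)
    (model_act (k i *: hcc_basis t u v i) phi) =
    k i * eval_at (0%MM, 0%MM, 1%g, fun=> false) (model_act (hcc_basis t u v i) phi).
  by rewrite [model_act (_ *: _)]pres_liftZ.
rewrite (eq_bigr _ (fun i _ => term i)) (bigD1_seq p0) // big1 => [|i ip0].
  have [sg ->] := basis_shifts p0; rewrite /= addr0 eval_pt eqxx mulr1 => ksg.
  have : (-1) ^+ sg * (k p0 * (-1) ^+ sg) = 0 by rewrite ksg mulr0.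
  by rewrite mulrC -mulrA -signr_addb addbb mulr1.
have [sg ->] := basis_shifts i; rewrite eval_pt (inj_eq index_point_inj).
by rewrite (negPf ip0) !mulr0.
Qed.

End Model.

(** * Spanning *)

Section LSpan.
Variables (K : comNzRingType) (V : lmodType K) (I : choiceType) (b : I -> V).

Definition lspan (v : V) : Prop := exists a : {malg K[I]}, v = lin_ext b a.

Lemma lspan_gen i : lspan (b i).
Proof. by exists (mkmalgU i 1); rewrite lin_extU. Qed.

Lemma lspan0 : lspan 0. Proof. by exists 0; rewrite linear0. Qed.

Lemma lspanD u v : lspan u -> lspan v -> lspan (u + v).
Proof. by move=> [a ->] [a' ->]; exists (a + a'); rewrite linearD. Qed.

Lemma lspanZ k v : lspan v -> lspan (k *: v).
Proof. by move=> [a ->]; exists (k *: a); rewrite linearZ. Qed.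

Lemma lspan_sum (J : Type) (s : seq J) (P : pred J) (F : J -> V) :
  (forall j, P j -> lspan (F j)) -> lspan (\sum_(j <- s | P j) F j).
Proof. by move=> h; elim/big_ind: _ => //; [exact: lspan0 | exact: lspanD]. Qed.

Lemma lspan_ind (P : V -> Prop) : P 0 -> (forall u v, P u -> P v -> P (u + v)) ->
  (forall k v, P v -> P (k *: v)) -> (forall i, P (b i)) ->
  forall v, lspan v -> P v.
Proof.
move=> P0 PD PZ Pb _ [a ->]; rewrite /lin_ext /malg_ext.
by elim/big_ind: _ => // i _; exact/PZ/Pb.
Qed.

Lemma lspan_spanning : (forall v, lspan v) -> spanning b.
Proof. by move=> h v; have [a ->] := h v; exists (monalg.msupp a), (monalg.mcoeff^~ a). Qed.

Lemma spanning_lspan : spanning b -> forall v, lspan v.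
Proof.
move=> h v; have [s [k ->]] := h v.
by apply: lspan_sum => i _; exact/lspanZ/lspan_gen.
Qed.

End LSpan.

Section Monomials.
Variables (n : nat) (A : pzRingType) (L : 'I_n -> A).
Implicit Types (s : seq 'I_n) (i j : 'I_n).

Lemma prod_ind (Q : A -> Prop) (m : 'I_n -> nat) s v :
  (forall i a, Q a -> Q (L i * a)) -> Q v -> Q (\prod_(i <- s) L i ^+ m i * v).
Proof.
move=> QL Qv; elim: s => [|i s IHs]; first by rewrite big_nil mul1r.
rewrite big_cons -mulrA; elim: (m i) => [|k IHk]; first by rewrite mul1r.
by rewrite exprS -mulrA; exact: QL.
Qed.

Lemma comm_prod_mul1 (m : 'I_n -> nat) s j :
  (forall i j, L i * L j = L j * L i) -> uniq s -> j \in s ->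
  L j * (\prod_(i <- s) L i ^+ m i) = \prod_(i <- s) L i ^+ (m i + (i == j)).
Proof.
move=> LC; elim: s => // i s IHs /= /andP[is_ us]; rewrite !big_cons inE.
case: (eqVneq j i) => [->|ji] /= js.
  rewrite mulrA -exprS addn1; congr (_ * _); rewrite big_seq [RHS]big_seq.
  by apply: eq_bigr => k ks; case: eqP ks is_ => [-> ->|] //; rewrite addn0.
rewrite addn0 -IHs // !mulrA; congr (_ * _).
exact/commrX/LC.
Qed.

Lemma clifford_prod_mul1 (m : 'I_n -> bool) s j :
  (forall i, L i * L i = 1) ->
  (forall i j, i != j -> L i * L j = - (L j * L i)) -> uniq s -> j \in s ->
  exists p : bool, L j * (\prod_(i <- s) L i ^+ (m i : nat)) =
    (-1) ^+ p * \prod_(i <- s) L i ^+ ((m i (+) (i == j)) : nat).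
Proof.
move=> L2 LL; elim: s => // i s IHs /= /andP[is_ us]; rewrite inE.
case: (eqVneq j i) => [->|ji] /= js.
  exists false; rewrite mul1r !big_cons eqxx mulrA; congr (_ * _).
    by case: (m i); rewrite //= ?expr1 ?expr0 ?mulr1 ?L2.
  rewrite big_seq [RHS]big_seq.
  by apply: eq_bigr => k ks; case: eqP ks is_ => [-> ->|] //; rewrite addbF.
have [p pE] := IHs us js; exists (p (+) m i).
rewrite !big_cons eq_sym (negPf ji) addbF mulrA.
have -> : L j * L i ^+ m i = (-1) ^+ m i * (L i ^+ m i * L j).
  by case: (m i); rewrite ?expr1 ?expr0 ?mulr1 ?mul1r // LL // mulN1r.
by rewrite -!mulrA pE signCA mulrA -signr_addb addbC.
Qed.

Lemma anti_prod_comm (d : A) (m : 'I_n -> bool) s :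
  (forall i, exists p : bool, d * L i = (-1) ^+ p * (L i * d)) ->
  exists p : bool, d * (\prod_(i <- s) L i ^+ (m i : nat)) =
    (-1) ^+ p * ((\prod_(i <- s) L i ^+ (m i : nat)) * d).
Proof.
move=> dL; elim: s => [|i s [p IHs]].
  by exists false; rewrite big_nil mulr1 !mul1r.
have [q dLi] := dL i; rewrite big_cons; exists (p (+) (m i && q)).
case: (m i) => /=; last by rewrite expr0 mul1r addbF.
by rewrite expr1 mulrA dLi -!mulrA IHs signCA addbC signr_addb -[RHS]mulrA.
Qed.

End Monomials.

Section FreeWords.
Variables (K : comNzRingType) (X : choiceType).

Lemma free_word (m : {fmonom X}) :
  mkmalgU m 1 = \prod_(x <- m) fgen K x :> free_alg K X.
Proof.
case: m => s /=; elim: s => [|x s IHs].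
  by rewrite big_nil -fmoneE.
rewrite big_cons -IHs; have -> : fgen K x * mkmalgU (FMonom s) 1 =
    mkmalgU (mmul (fmu x) (FMonom s)) (1 * 1) :> free_alg K X.
  by rewrite malgM_def fgmulUU.
by rewrite mulr1; congr (mkmalgU _ 1); apply/val_inj; rewrite /= fmM fmU.
Qed.

Lemma free_alg_ind (P : free_alg K X -> Prop) : P 0 -> P 1 ->
  (forall k a b, P a -> P b -> P (k *: a + b)) ->
  (forall x a, P a -> P (fgen K x * a)) -> forall a, P a.
Proof.
move=> P0 P1 Plin Pgen a; rewrite [a]monalgE.
elim/big_rec: _ => // m b _ Pb.
rewrite mkmalgUZ; apply: Plin => //; rewrite free_word.
by elim: (m : seq X) => [|x s IHs]; rewrite ?big_nil ?big_cons //; exact: Pgen.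
Qed.

End FreeWords.

Section NormalForms.
Variables (K : comNzRingType) (T : weyl_type) (n : nat) (A : pzRingType).
Variable iota : {rmorphism K -> A}.
Hypothesis iotaC : forall k a, iota k * a = a * iota k.
Variables (x y c e : 'I_n -> A) (w : weyl n T -> A) (t u v : K).
Hypothesis re : hcc_realization iota x y c e w t u v.

Let cw := re_cw re.
Let xp := re_x re.
Let yp := re_y re.

Let X (a : 'I_n -> nat) : A := \prod_(i < n) x i ^+ a i.
Let Y (b : 'I_n -> nat) : A := \prod_(i < n) y i ^+ b i.
Let C (eps : 'I_n -> bool) : A := \prod_(i < n) c i ^+ (eps i : nat).
Let E (eps : 'I_n -> bool) : A := \prod_(i < n) e i ^+ (eps i : nat).

(** The span of the ordered products. It absorbs left multiplication by each
generator, which is proved for x, c, e, w and y in this order: a generator moves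
right through the groups that precede its own, and these were treated before. *)
Inductive normal_form : A -> Prop :=
| nf_0 : normal_form 0
| nf_Z k a : normal_form a -> normal_form (iota k * a)
| nf_D a a' : normal_form a -> normal_form a' -> normal_form (a + a')
| nf_basis a eps g eps' b :
    normal_form (X a * (C eps * (w g * (E eps' * Y b)))).
Local Notation S := normal_form.

Let stab (z : A) : Prop := forall a, S a -> S (z * a).

Let stabI z : (forall a eps g eps' b, S (z * (X a * (C eps * (w g * (E eps' * Y b)))))) ->
  stab z.
Proof.
move=> zS a; elim=> [|k b _ Sb|b d _ Sb _ Sd|//].
- by rewrite mulr0; exact: nf_0.
- by rewrite (iotaCA iotaC); exact: nf_Z.
- by rewrite mulrDr; exact: nf_D.
Qed.

Let S_sign (p : bool) a : S a -> S ((-1) ^+ p * a).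
Proof. by rewrite -(rmorph_sign iota); exact: nf_Z. Qed.

Let stab1 : stab 1. Proof. by move=> a; rewrite mul1r. Qed.
Let stabM z z' : stab z -> stab z' -> stab (z * z').
Proof. by move=> h h' a Sa; rewrite -mulrA; apply/h/h'. Qed.
Let stabD z z' : stab z -> stab z' -> stab (z + z').
Proof. by move=> h h' a Sa; rewrite mulrDl; apply: nf_D; [apply: h|apply: h']. Qed.
Let stab_sign (p : bool) z : stab z -> stab ((-1) ^+ p * z).
Proof. by move=> h a Sa; rewrite -mulrA; exact/S_sign/h. Qed.
Let stabN z : stab z -> stab (- z).
Proof. by move=> h; rewrite -mulN1r; exact: (@stab_sign true). Qed.
Let stabZ k z : stab z -> stab (iota k * z).
Proof. by move=> h a Sa; rewrite -mulrA; exact/nf_Z/h. Qed.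
Let stab0 : stab 0.
Proof. by move=> a _; rewrite mul0r; exact: nf_0. Qed.
Let stab_sum (J : Type) (s : seq J) (P : pred J) (F : J -> A) :
  (forall j, P j -> stab (F j)) -> stab (\sum_(j <- s | P j) F j).
Proof. by move=> h; elim/big_ind: _ => //; exact: stabD. Qed.

Let L0 (L : 'I_n -> A) : \prod_(i < n) L i ^+ 0 = 1.
Proof. by rewrite big1 // => i _; rewrite expr0. Qed.

Let S_cwey eps g eps' b : S (C eps * (w g * (E eps' * Y b))).
Proof. by have := nf_basis (fun=> 0%N) eps g eps' b; rewrite /X L0 mul1r. Qed.

Let S_wey g eps' b : S (w g * (E eps' * Y b)).
Proof. by have := S_cwey (fun=> false) g eps' b; rewrite /C L0 mul1r. Qed.

Lemma stab_x j : stab (x j).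
Proof.
apply: stabI => a eps g eps' b; rewrite mulrA.
rewrite (comm_prod_mul1 _ (re_xx re)) ?index_enum_uniq ?mem_index_enum //.
exact: nf_basis.
Qed.

Lemma stab_c j : stab (c j).
Proof.
apply: stabI => a eps g eps' b.
move: j; apply: (prod_ind (Q := fun z => forall j, S (c j * z))) => [i z Qz|] j.
  rewrite mulrA (po_cx xp) -!mulrA; exact/S_sign/stab_x/Qz.
have [p pE] := clifford_prod_mul1 (fun i => eps i) (cw_c2 cw) (cw_cc cw)
  (index_enum_uniq _) (mem_index_enum j).
rewrite mulrA pE -mulrA; apply: S_sign.
exact: (S_cwey (fun i => eps i (+) (i == j))).
Qed.

Lemma stab_e j : stab (e j).
Proof.
apply: stabI => a eps g eps' b.
move: j; apply: (prod_ind (Q := fun z => forall j, S (e j * z))) => [i z Qz|] j.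
  by rewrite mulrA (po_ex xp) -!mulrA; exact/stab_x/Qz.
move: j; apply: (prod_ind (Q := fun z => forall j, S (e j * z))) => [i z Qz|] j.
  rewrite mulrA -[e j * c i]opprK -(cw_ce cw) mulNr -mulrA.
  by rewrite -mulN1r; exact/(@S_sign true)/stab_c/Qz.
rewrite -(wabsKV g j); move: (wabs _ j) => {}j.
have -> : e (wabs g j) * (w g * (E eps' * Y b)) =
   (-1) ^+ wsgn g j * (w g * (e j * E eps' * Y b)).
  by rewrite -(mulrA (e j)) 2![w g * (_ * _)]mulrA (cw_e cw) /signed_act -!mulrA signK.
have [p pE] := clifford_prod_mul1 (fun i => eps' i) (cw_e2 cw) (cw_ee cw)
  (index_enum_uniq _) (mem_index_enum j).
rewrite pE -mulrA signCA; apply/S_sign/S_sign.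
exact: (S_wey _ (fun i => eps' i (+) (i == j))).
Qed.

Lemma stab_w h : stab (w h).
Proof.
apply: stabI => a eps g eps' b.
apply: (prod_ind (Q := fun z => S (w h * z))) => [i z Qz|].
  rewrite mulrA (po_wx xp) /signed_act -!mulrA; exact/S_sign/stab_x/Qz.
apply: (prod_ind (Q := fun z => S (w h * z))) => [i z Qz|].
  rewrite mulrA (cw_c cw) /signed_act -!mulrA; exact/S_sign/stab_c/Qz.
by rewrite mulrA (cw_M cw); exact: S_wey.
Qed.

Let stab_refl_factor (L : 'I_n -> A) (p : bool) (i j : 'I_n) :
  (forall k, stab (L k)) -> stab (refl_factor L p i j).
Proof. by move=> h; apply: stabD; [exact: stab1|exact/stab_sign/stabM]. Qed.

Let stab_yx i j : stab (yx_comm iota c e w t u v i j).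
Proof.
have stab_term p i1 i2 j1 j2 h :
    stab (refl_factor c p i1 i2 * (refl_factor e p j1 j2 * w h)).
  apply: stabM; first exact/stab_refl_factor/stab_c.
  by apply: stabM; [exact/stab_refl_factor/stab_e | exact: stab_w].
rewrite /yx_comm /diag_comm /off_comm /off_term /diag_term /tau_term.
case: eqP => _; last first.
  by apply/stabZ/stab_sum => p _; apply: stab_sign.
apply: stabD; last apply: stabN; last first.
  by case: ifP => _; [exact/stabZ/stab_w | exact: stab0].
apply: stabD; first by apply/stabZ/stabM; [exact: stab_c | exact: stab_e].
by apply/stabN/stabZ/stab_sum => k _; apply: stab_sum.
Qed.

(** Moving y_j past x_i produces a commutator, a polynomial in the c's, e's and
w's, which the span absorbs by the preceding lemmas. *)
Lemma stab_y j : stab (y j).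
Proof.
apply: stabI => a eps g eps' b.
(* Both memberships are needed: the commutator multiplies the product itself. *)
suff [_ h] : S (X a * (C eps * (w g * (E eps' * Y b)))) /\
  forall j, S (y j * (X a * (C eps * (w g * (E eps' * Y b))))) by exact: h.
apply: (prod_ind (Q := fun z => S z /\ forall j, S (y j * z))) => [i z [Sz Qz]|].
  split=> [|{}j]; first exact: stab_x.
  rewrite mulrA (re_yx re) mulrDl -mulrA; apply: nf_D; first exact/stab_x/Qz.
  exact: stab_yx.
split=> [|{}j]; first exact: S_cwey.
move: j; apply: (prod_ind (Q := fun z => forall j, S (y j * z))) => [i z Qz|] j.
  by rewrite mulrA -(po_ex yp) -mulrA; exact/stab_c/Qz.
rewrite -(wabsKV g j); move: (wabs _ j) => {}j.
have [p pE] := @anti_prod_comm n _ e (y j) eps' (index_enum _) (fun i =>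
  ex_intro _ (i == j) (esym (etrans (congr1 _ (po_cx yp i j)) (signK _ _)))).
have -> : y (wabs g j) * (w g * (E eps' * Y b)) =
   (-1) ^+ wsgn g j * (w g * (y j * E eps' * Y b)).
  by rewrite -(mulrA (y j)) 2![w g * (_ * _)]mulrA (po_wx yp) /signed_act -!mulrA signK.
rewrite pE -!mulrA signCA; apply/S_sign/S_sign.
rewrite (comm_prod_mul1 _ (re_yy re)) ?index_enum_uniq ?mem_index_enum //.
exact: (S_wey _ eps').
Qed.

Lemma normal_form1 : normal_form 1.
Proof.
have := S_wey 1%g (fun=> false) (fun=> 0%N).
by rewrite /E /Y !L0 (cw_1 cw) !mulr1.
Qed.

End NormalForms.

Lemma mulr5A (A : pzRingType) (a b c d e : A) :
  a * (b * (c * (d * e))) = a * b * c * d * e.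
Proof. by rewrite !mulrA. Qed.

Section HccSpanning.
Variables (K : comNzRingType) (T : weyl_type) (n : nat) (t u v : K).

Let re := hcc_realizes T n t u v.
Let iotaC := @pres_scalarC K _ (@hcc_rel K T n t u v).

Lemma hcc_normal_form z : normal_form (@pres_scalar K _ (@hcc_rel K T n t u v))
  (hcc_x T t u v) (hcc_y T t u v) (hcc_c T t u v) (hcc_e T t u v)
  (@hcc_w K T n t u v) z.
Proof.
elim/presW: z => a; rewrite -[\pi_ _ a]/(pres_pi _ a).
elim/free_alg_ind: a => [||k a b Sa Sb|g a Sa].
- by rewrite raddf0; exact: nf_0.
- by rewrite rmorph1; exact: normal_form1 re.
- by rewrite raddfD /= pres_piZ; apply: nf_D Sb; exact: nf_Z.
rewrite rmorphM; case: g => [i|i|i|i|g].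
- exact: (stab_x iotaC re).
- exact: (stab_y iotaC re).
- exact: (stab_c iotaC re).
- exact: (stab_e iotaC re).
- exact: (stab_w iotaC re).
Qed.

Theorem hcc_basis_spanning : spanning (@hcc_basis K T n t u v).
Proof.
apply: lspan_spanning => z.
elim: (hcc_normal_form z) => [|k a _ Sa|a b _ Sa _ Sb|a eps g eps' b].
- exact: lspan0.
- by rewrite pres_scalarE; exact: lspanZ.
- exact: lspanD.
set y := (X in lspan _ X); suff -> : y = hcc_basis t u v
  ([ffun i => a i], [ffun i => eps i], g, [ffun i => eps' i], [ffun i => b i]).
  exact: lspan_gen.
apply: esym; apply: etrans (esym (mulr5A _ _ _ _ _)) _.
by congr (_ * (_ * (_ * (_ * _)))); apply: eq_bigr => i _; rewrite ffunE.
Qed.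

End HccSpanning.

(** * The multiplication map *)

Section MpolyLift.
Variables (K : comNzRingType) (n : nat) (A : pzRingType).
Variables (iota : {rmorphism K -> A}) (iotaC : forall k a, iota k * a = a * iota k).
Variables (h : 'I_n -> A) (hC : forall i j, h i * h j = h j * h i).
Implicit Types (p q : {mpoly K[n]}) (m : 'X_{1..n}).

Let word (m : 'I_n -> nat) : A := \prod_(i < n) h i ^+ m i.

Definition mpoly_map p : A := \sum_(m <- msupp p) iota p@_m * word m.

Lemma mpoly_mapEw (d : seq 'X_{1..n}) p : uniq d -> {subset msupp p <= d} ->
  mpoly_map p = \sum_(m <- d) iota p@_m * word m.
Proof.
move=> ud pd; rewrite [RHS](bigID (mem (msupp p))) /= [X in _ = _ + X]big1 ?addr0.
  rewrite -big_filter; apply/perm_big/uniq_perm; rewrite ?filter_uniq ?msupp_uniq //.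
  by move=> m; rewrite mem_filter andb_idr // => /pd.
by move=> m /memN_msupp_eq0 ->; rewrite rmorph0 mul0r.
Qed.

Fact mpoly_map_is_zmod_morphism : zmod_morphism mpoly_map.
Proof.
move=> p q; pose d := undup (msupp p ++ msupp q).
have ud : uniq d := undup_uniq _.
rewrite (@mpoly_mapEw d p) // ?(@mpoly_mapEw d q) // ?(@mpoly_mapEw d (p - q)) //.
- by rewrite -sumrB; apply: eq_bigr => m _; rewrite mcoeffB rmorphB mulrBl.
- by move=> m /msuppB_le; rewrite mem_undup.
- by move=> m mq; rewrite mem_undup mem_cat mq orbT.
- by move=> m mp; rewrite mem_undup mem_cat mp.
Qed.
HB.instance Definition _ := GRing.isZmodMorphism.Build {mpoly K[n]} A mpoly_map
  mpoly_map_is_zmod_morphism.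

Lemma mpoly_mapZX k m : mpoly_map (k *: 'X_[m]) = iota k * word m.
Proof.
rewrite (@mpoly_mapEw [:: m]) // => [|m' /msuppZ_le].
  by rewrite big_seq1 mcoeffZ mcoeffX eqxx mulr1.
by rewrite msuppX.
Qed.

Let wordD m m' : word (m + m')%MM = word m * word m'.
Proof.
rewrite /word; elim: (index_enum _) => [|i s IHs]; first by rewrite !big_nil mulr1.
rewrite !big_cons IHs mnmDE exprD -!mulrA; congr (_ * _); rewrite !mulrA; congr (_ * _).
apply: commr_prod => j _; exact/commrX/commr_sym/commrX/hC.
Qed.

Fact mpoly_map_is_monoid_morphism : monoid_morphism mpoly_map.
Proof.
split=> [|p q].
  rewrite -[1]scale1r -mpolyX0 mpoly_mapZX rmorph1 mul1r.
  by rewrite /word big1 // => i _; rewrite mnm0E.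
rewrite [p]mpolyE [q]mpolyE mulr_suml !raddf_sum mulr_suml.
apply: eq_bigr => m _; rewrite mulr_sumr !raddf_sum mulr_sumr.
apply: eq_bigr => m' _.
rewrite -scalerAl -scalerAr scalerA -mpolyXD /= !mpoly_mapZX rmorphM wordD.
by rewrite -!mulrA; congr (_ * _); rewrite !mulrA iotaC.
Qed.
HB.instance Definition _ := GRing.isMonoidMorphism.Build {mpoly K[n]} A mpoly_map
  mpoly_map_is_monoid_morphism.

Definition mpoly_lift : {rmorphism {mpoly K[n]} -> A} := mpoly_map.

Lemma mpoly_liftX m : mpoly_lift 'X_[m] = \prod_(i < n) h i ^+ m i.
Proof. by rewrite -['X_[m]]scale1r /mpoly_lift /= mpoly_mapZX rmorph1 mul1r. Qed.

Lemma mpoly_liftXU i : mpoly_lift 'X_i = h i.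
Proof.
rewrite mpoly_liftX; have s := index_enum_uniq 'I_n; have := mem_index_enum i.
elim: (index_enum _) s => // j s IHs /= /andP[js us]; rewrite inE big_cons mnm1E.
case: (eqVneq i j) => [-> _|ij /= /(IHs us) ->]; last by rewrite mul1r.
rewrite big_seq big1 ?mulr1 // => k ks.
by rewrite mnm1E; case: eqP ks js => [<- ->|].
Qed.

Lemma mpoly_liftZ k p : mpoly_lift (k *: p) = iota k * mpoly_lift p.
Proof.
rewrite [p]mpolyE scaler_sumr !raddf_sum mulr_sumr; apply: eq_bigr => m _.
by rewrite scalerA /mpoly_lift /= !mpoly_mapZX rmorphM mulrA.
Qed.

End MpolyLift.

Section CliffordLift.
Variables (K : comNzRingType) (n : nat) (A : pzRingType).
Variables (iota : {rmorphism K -> A}) (iotaC : forall k a, iota k * a = a * iota k).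
Variables (c e : 'I_n -> A).
Hypothesis cliff : forall a b, clifford_rel c e a b -> a = b.

Definition clifford_image (i : 'I_n + 'I_n) : A :=
  match i with inl i => c i | inr i => e i end.

Lemma clifford_image_rel a b :
  clifford_rel (fun i : 'I_n => fgen K (inl i)) (fun i => fgen K (inr i)) a b ->
  free_lift iotaC clifford_image a = free_lift iotaC clifford_image b.
Proof.
have gl i : free_lift iotaC clifford_image (fgen K (inl i)) = c i.
  exact: free_lift_gen.
have gr i : free_lift iotaC clifford_image (fgen K (inr i)) = e i.
  exact: free_lift_gen.
case=> [i|i|i j ij|i j ij|i j].
- by apply/rmorph_sqr1; rewrite gl; exact/cliff/clifford_c2.
- by apply/rmorph_sqr1; rewrite gr; exact/cliff/clifford_e2.
- by apply/rmorph_anti; rewrite !gl; exact/cliff/clifford_cc.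
- by apply/rmorph_anti; rewrite !gr; exact/cliff/clifford_ee.
- by apply/rmorph_anti; rewrite gl gr; exact/cliff/clifford_ce.
Qed.

Definition clifford_lift : {rmorphism clifford K n -> A} :=
  pres_lift clifford_image_rel.

Lemma clifford_lift_c i : clifford_lift (clif_c K i) = c i.
Proof. exact: (pres_lift_gen clifford_image_rel (inl i)). Qed.
Lemma clifford_lift_e i : clifford_lift (clif_e K i) = e i.
Proof. exact: (pres_lift_gen clifford_image_rel (inr i)). Qed.
Lemma clifford_liftZ k a : clifford_lift (k *: a) = iota k * clifford_lift a.
Proof. exact: (pres_liftZ clifford_image_rel). Qed.

End CliffordLift.

(** * Bijectivity of the multiplication map *)

Section LSpanMore.
Variable (K : comNzRingType).

Lemma lspan_sub (V : lmodType K) (I J : choiceType) (b : I -> V) (b' : J -> V) v :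
  (forall i, exists j, b i = b' j) -> lspan b v -> lspan b' v.
Proof.
move=> bb'; move: v; apply: lspan_ind => [|u v|k v|i].
- exact: lspan0.
- exact: lspanD.
- exact: lspanZ.
- by have [j ->] := bb' i; exact: lspan_gen.
Qed.

(** A linear relation between the [b i] would be mapped to one between the
[b' i]; hence the spanning family need not be known to be free. *)
Lemma linear_bijective (V V' : lmodType K) (I : choiceType) (f : {linear V -> V'})
    (b : I -> V) (b' : I -> V') :
  (forall v, lspan b v) -> is_basis b' ->
  (forall i, exists p : bool, f (b i) = (-1) ^+ p *: b' i) -> bijective f.
Proof.
move=> bV [b'free b'V'] fb.
have f0 v : f v = 0 -> v = 0.
  have [a ->] := bV v; rewrite /lin_ext /malg_ext raddf_sum => sum0.
  pose sg i : bool := sval (cid (fb i)).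
  have sgE i : f (b i) = (-1) ^+ sg i *: b' i by exact: (svalP (cid (fb i))).
  apply: big1_seq => i /andP[_ ia]; rewrite /= /scale_to.
  have free0 := b'free (monalg.msupp a) (fun i => monalg.mcoeff i a * (-1) ^+ sg i)
    (fset_uniq _).
  have /free0 ai0 :
      \sum_(i <- monalg.msupp a) (monalg.mcoeff i a * (-1) ^+ sg i) *: b' i = 0.
    rewrite -[RHS]sum0; apply: eq_bigr => j _.
    by rewrite /= /scale_to linearZ /= sgE scalerA.
  have /(congr1 ( *%R^~ ((-1) ^+ sg i))) := ai0 i ia.
  by rewrite /= mul0r -mulrA -signr_addb addbb mulr1 => ->; rewrite scale0r.
have finj : injective f.
  by move=> v v' /eqP; rewrite -subr_eq0 -raddfB => /eqP/f0/eqP; rewrite subr_eq0 => /eqP.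
have fsurj v' : exists v, f v = v'.
  have := spanning_lspan b'V' v'; move: v'.
  apply: lspan_ind => [|u' v' [u <-] [v <-]|k v' [v <-]|i].
  - by exists 0; rewrite raddf0.
  - by exists (u + v); rewrite raddfD.
  - by exists (k *: v); rewrite linearZ.
  - have [p fbp] := fb i; exists ((-1) ^+ p *: b i).
    by rewrite linearZ /= fbp scalerA -signr_addb addbb scale1r.
exists (fun v' => sval (cid (fsurj v'))) => v; last exact: (svalP (cid (fsurj v))).
by apply: finj; exact: (svalP (cid (fsurj (f v)))).
Qed.

End LSpanMore.

Section TensorSpan.
Variables (K : comNzRingType) (U V : lmodType K).

Let pi0 : \pi_(tensor U V) 0 = 0.
Proof.
by apply: (addrI (\pi_(tensor U V) 0)); rewrite addr0 -(lquotD _ 0 0) addr0.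
Qed.

Lemma tens_rel (a : {malg K[(U * V)%type]}) : tensor_rel a -> \pi_(tensor U V) a = 0.
Proof.
move=> ra; rewrite -pi0; apply/(@lquotP _ _ (span_pred (@tensor_rel K U V)) a 0).
by rewrite subr0; apply/asboolP/span_mem.
Qed.

Let piN a b : \pi_(tensor U V) (a - b) = \pi_(tensor U V) a - \pi_(tensor U V) b.
Proof. by rewrite -scaleN1r addrC tensor_pi_is_linear scaleN1r addrC. Qed.

Let pi3 a b d : \pi_(tensor U V) (a - b - d) = 0 ->
  \pi_(tensor U V) a = \pi_(tensor U V) b + \pi_(tensor U V) d.
Proof. by rewrite 2!piN -addrA -opprD => /eqP; rewrite subr_eq0 => /eqP. Qed.

Lemma tensDl (u u' : U) (v : V) : tens (u + u') v = tens u v + tens u' v.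
Proof. exact/pi3/tens_rel/tensor_Dl. Qed.
Lemma tensDr (u : U) (v v' : V) : tens u (v + v') = tens u v + tens u v'.
Proof. exact/pi3/tens_rel/tensor_Dr. Qed.

Let piZ k a : \pi_(tensor U V) (k *: a) = k *: \pi_(tensor U V) a.
Proof. exact/esym/(lquotZ _ k a). Qed.

Lemma tensZl k (u : U) (v : V) : tens (k *: u) v = k *: tens u v.
Proof.
have /eqP := tens_rel (tensor_Zl k u v).
by rewrite piN piZ subr_eq0 => /eqP.
Qed.
Lemma tensZr k (u : U) (v : V) : tens u (k *: v) = k *: tens u v.
Proof.
have /eqP := tens_rel (tensor_Zr k u v).
by rewrite piN piZ subr_eq0 => /eqP.
Qed.

Lemma tens_lspan (I J : choiceType) (b : I -> U) (b' : J -> V) :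
  (forall u, lspan b u) -> (forall v, lspan b' v) ->
  forall z, lspan (fun p : I * J => tens (b p.1) (b' p.2)) z.
Proof.
move=> bU b'V z; set T := lspan _.
have T0 : T 0 by exact: lspan0.
have TD u v : T u -> T v -> T (u + v) by exact: lspanD.
have TZ k v : T v -> T (k *: v) by exact: lspanZ.
have Tt u v : T (tens u v).
  have t0l (w : V) : tens (0 : U) w = 0 by rewrite -(scale0r (0 : U)) tensZl scale0r.
  have t0r (w : U) : tens w (0 : V) = 0 by rewrite -(scale0r (0 : V)) tensZr scale0r.
  move: u (bU u); apply: lspan_ind => [|u u' Tu Tu'|k u Tu|i].
  - by rewrite t0l.
  - by rewrite tensDl; exact: TD.
  - by rewrite tensZl; exact: TZ.
  move: v (b'V v); apply: lspan_ind => [|v v' Tv Tv'|k v Tv|j].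
  - by rewrite t0r.
  - by rewrite tensDr; exact: TD.
  - by rewrite tensZr; exact: TZ.
  exact: (lspan_gen _ (i, j)).
elim/lquotW: z => a; rewrite [a]monalgE.
have : forall s : seq (U * V),
    T (\pi_(tensor U V) (\sum_(i <- s) mkmalgU i (monalg.mcoeff i a))).
  elim=> [|i s IHs].
    by rewrite big_nil pi0.
  rewrite big_cons mkmalgUZ tensor_pi_is_linear; apply: TD (IHs); apply: TZ.
  by case: i => u v; exact: Tt.
exact.
Qed.

End TensorSpan.

(** The subalgebra generated by pairwise anticommuting square roots of 1 is
spanned by their ordered products. *)
Section CliffordSpan.
Variables (K : comNzRingType) (X : choiceType).
Variables (r : free_alg K X -> free_alg K X -> Prop) (n : nat) (L : 'I_n -> pres r).
Hypotheses (L2 : forall i, L i * L i = 1)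
  (LL : forall i j, i != j -> L i * L j = - (L j * L i)).
Variable S : pres r -> Prop.
Hypothesis SE : forall a, S a <-> exists i, a = L i.

Definition square_free (eps : {ffun 'I_n -> bool}) : pres r :=
  \prod_(i < n) L i ^+ (eps i : nat).

Let signE (p : bool) (a : pres r) : (-1) ^+ p * a = (-1) ^+ p *: a.
Proof. by case: p; rewrite ?mulN1r ?scaleN1r ?mul1r ?scale1r. Qed.

Let L_square_free i eps : exists p : bool, L i * square_free eps =
  (-1) ^+ p *: square_free [ffun j => eps j (+) (j == i)].
Proof.
have [p pE] := clifford_prod_mul1 eps L2 LL (index_enum_uniq _) (mem_index_enum i).
exists p; rewrite -signE; apply: etrans pE _; congr (_ * _).
by apply: eq_bigr => j _; rewrite ffunE.
Qed.

Lemma subalg_square_free a : subalg_gen S a -> lspan square_free a.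
Proof.
have one : lspan square_free 1.
  have -> : 1 = square_free [ffun=> false].
    by rewrite /square_free big1 // => i _; rewrite ffunE.
  exact: lspan_gen.
move=> Sa; suff h z : lspan square_free z -> lspan square_free (a * z).
  by rewrite -[a]mulr1; exact: h.
elim: Sa z => {a} [a /SE[i ->]|//|k a a' _ IHa _ IHa'|a a' _ IHa _ IHa'] z Sz.
- move: z Sz; apply: lspan_ind => [|u v Su Sv|k u Su|eps].
  + by rewrite mulr0; exact: lspan0.
  + by rewrite mulrDr; exact: lspanD.
  + by rewrite -pres_scaleAr; exact: lspanZ.
  + by have [p ->] := L_square_free i eps; exact/lspanZ/lspan_gen.
- by rewrite mul1r.
- by rewrite mulrDl -pres_scaleAl; apply: lspanD; [exact/lspanZ/IHa | exact: IHa'].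
- by rewrite -mulrA; exact/IHa/IHa'.
Qed.

Fact square_free_subproof eps : square_free eps \in subalg_pred S.
Proof.
apply: rpred_prod => i _; apply: rpredX; apply/asboolP/subalg_mem/SE.
by exists i.
Qed.

Definition subalg_mono eps : subalg S := Subalg (square_free_subproof eps).

Lemma subalg_mono_lspan (z : subalg S) : lspan subalg_mono z.
Proof.
have [a za] : lspan square_free (subalg_val z).
  by apply: subalg_square_free; case: z => z /= /asboolP.
exists a; apply: val_inj; rewrite /= za /lin_ext /malg_ext.
rewrite [RHS](raddf_sum (val : subalg S -> pres r)).
by apply: eq_bigr => i _.
Qed.

End CliffordSpan.

Section MultiplicationMap.

(** The multiplication map puts the y's before the e's, the basis the other way
round. *)
Lemma polar_prod_comm (T : weyl_type) (n : nat) (A : pzRingType)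
    (y e c : 'I_n -> A) (w : weyl n T -> A) (b : 'I_n -> nat) (eps : 'I_n -> bool) :
  polar y e c w -> exists p : bool,
  (\prod_(i < n) y i ^+ b i) * (\prod_(i < n) e i ^+ (eps i : nat)) =
  (-1) ^+ p * ((\prod_(i < n) e i ^+ (eps i : nat)) * (\prod_(i < n) y i ^+ b i)).
Proof.
move=> yp; set E := \prod_(i < n) e i ^+ _.
have yE j : exists p : bool, y j * E = (-1) ^+ p * (E * y j).
  by apply: anti_prod_comm => i; exists (i == j); rewrite (po_cx yp) signK.
have := @prod_ind n A y (fun z => exists p : bool, z * E = (-1) ^+ p * (E * z))
  b (index_enum 'I_n) 1; rewrite !mulr1; apply=> [j a [p aE]|].
  have [q jE] := yE j; exists (p (+) q).
  by rewrite -mulrA aE signCA (mulrA (y j)) jE -!mulrA signr_addb -[RHS]mulrA.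
by exists false; rewrite !mul1r.
Qed.

Variables (K : comNzRingType).

Section TensorMul.
Variables (X : choiceType) (r : free_alg K X -> free_alg K X -> Prop).
Variables (U V : lmodType K) (F : U -> pres r) (G : V -> pres r).
Hypotheses (Fl : linear F) (Gl : linear G).

Fact mul_linear_l w : linear (fun u => F u * G w).
Proof. by move=> k u u'; rewrite Fl mulrDl -pres_scaleAl. Qed.
Fact mul_linear_r u : linear (fun w => F u * G w).
Proof. by move=> k w w'; rewrite Gl mulrDr -pres_scaleAr. Qed.

Definition tensor_mul : {linear tensor U V -> pres r} :=
  tensor_lift mul_linear_l mul_linear_r.

Lemma tensor_mulE u w : tensor_mul (tens u w) = F u * G w.
Proof. exact: tensor_liftE. Qed.

End TensorMul.

Variables (T : weyl_type) (n : nat) (t u v : K).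
Local Notation H := (hcc T n t u v).
Let re := hcc_realizes T n t u v.
Let iotaC := @pres_scalarC K _ (@hcc_rel K T n t u v).

Definition mul_X : {rmorphism {mpoly K[n]} -> H} := mpoly_lift iotaC (re_xx re).
Definition mul_Y : {rmorphism {mpoly K[n]} -> H} := mpoly_lift iotaC (re_yy re).
Definition mul_C : {rmorphism clifford K n -> H} :=
  clifford_lift iotaC (cw_clifford (re_cw re)).
Definition mul_W : {linear group_space K T n -> H} := lin_ext (hcc_w t u v).

Lemma mul_X_linear : linear mul_X.
Proof.
move=> k a b; apply: etrans (rmorphD mul_X _ _) _; congr (_ + _).
exact: etrans (mpoly_liftZ _ _ k a) (pres_scalarE k _).
Qed.
Lemma mul_Y_linear : linear mul_Y.
Proof.
move=> k a b; apply: etrans (rmorphD mul_Y _ _) _; congr (_ + _).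
exact: etrans (mpoly_liftZ _ _ k a) (pres_scalarE k _).
Qed.
Lemma mul_C_linear : linear mul_C.
Proof.
move=> k a b; apply: etrans (rmorphD mul_C _ _) _; congr (_ + _).
exact: etrans (clifford_liftZ _ _ k a) (pres_scalarE k _).
Qed.

Lemma mul_subalg_linear S : linear (fun a : @subalg K _ _ S => mul_C (subalg_val a)).
Proof. by move=> k a b; exact: mul_C_linear. Qed.

Definition mul_map : {linear (tensor (tensor (tensor (tensor {mpoly K[n]} (clifford_c K n))
    (group_space K T n)) {mpoly K[n]}) (clifford_e K n)) -> H} :=
  tensor_mul (linearP (tensor_mul (linearP (tensor_mul (linearP (tensor_mul
    mul_X_linear (@mul_subalg_linear _))) (linearP mul_W))) mul_Y_linear))
    (@mul_subalg_linear _).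

Lemma mul_mapE p c w q e : mul_map (tens (tens (tens (tens p c) w) q) e) =
  mul_X p * mul_C (subalg_val c) * mul_W w * mul_Y q * mul_C (subalg_val e).
Proof. by rewrite !tensor_mulE. Qed.

End MultiplicationMap.

Lemma rmorph_mono (R S : pzRingType) (f : {rmorphism R -> S}) (n : nat)
    (L : 'I_n -> R) (L' : 'I_n -> S) (m : 'I_n -> nat) :
  (forall i, f (L i) = L' i) ->
  f (\prod_(i < n) L i ^+ m i) = \prod_(i < n) L' i ^+ m i.
Proof. by move=> fL; rewrite rmorph_prod; apply: eq_bigr => i _; rewrite rmorphXn fL. Qed.

Lemma mulr_swap_last (A : pzRingType) (p : bool) (a b d y e a' b' d' y' e' : A) :
  a = a' -> b = b' -> d = d' -> y = y' -> e = e' ->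
  y' * e' = (-1) ^+ p * (e' * y') ->
  a * b * d * y * e = (-1) ^+ p * (a' * b' * d' * e' * y').
Proof. by move=> -> -> -> -> -> ye; rewrite -[LHS]mulrA ye signCA !mulrA. Qed.

Section Bijectivity.
Variables (K : comNzRingType) (T : weyl_type) (n : nat) (t u v : K).
Local Notation H := (hcc T n t u v).
Let re := hcc_realizes T n t u v.

Lemma clifford_relE (a b : clifford K n) :
  clifford_rel (@clif_c K n) (@clif_e K n) a b -> a = b.
Proof.
pose pi := @pres_pi K _
  (clifford_rel (fun i : 'I_n => fgen K (inl i)) (fun i => fgen K (inr i))).
case=> [i|i|i j ij|i j ij|i j].
- apply: (proj1 (rmorph_sqr1 pi _)); exact/pres_pi_rel/clifford_c2.
- apply: (proj1 (rmorph_sqr1 pi _)); exact/pres_pi_rel/clifford_e2.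
- apply: (proj1 (rmorph_anti pi _ _)); exact/pres_pi_rel/clifford_cc.
- apply: (proj1 (rmorph_anti pi _ _)); exact/pres_pi_rel/clifford_ee.
- apply: (proj1 (rmorph_anti pi _ _)); exact/pres_pi_rel/clifford_ce.
Qed.

Let c2 i : clif_c K i * clif_c K i = 1 :> clifford K n.
Proof. exact/clifford_relE/clifford_c2. Qed.
Let e2 i : clif_e K i * clif_e K i = 1 :> clifford K n.
Proof. exact/clifford_relE/clifford_e2. Qed.
Let cc i j : i != j ->
  clif_c K i * clif_c K j = - (clif_c K j * clif_c K i) :> clifford K n.
Proof. by move=> ij; exact/clifford_relE/clifford_cc. Qed.
Let ee i j : i != j ->
  clif_e K i * clif_e K j = - (clif_e K j * clif_e K i) :> clifford K n.
Proof. by move=> ij; exact/clifford_relE/clifford_ee. Qed.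

Let c_mono (eps : {ffun 'I_n -> bool}) : clifford_c K n :=
  subalg_mono (fun a => iff_refl (exists i, a = clif_c K i)) eps.
Let e_mono (eps : {ffun 'I_n -> bool}) : clifford_e K n :=
  subalg_mono (fun a => iff_refl (exists i, a = clif_e K i)) eps.

Let mul_c_mono eps : mul_C T n t u v (subalg_val (c_mono eps)) =
  \prod_(i < n) hcc_c T t u v i ^+ (eps i : nat).
Proof. by apply: rmorph_mono => i; exact: clifford_lift_c. Qed.
Let mul_e_mono eps : mul_C T n t u v (subalg_val (e_mono eps)) =
  \prod_(i < n) hcc_e T t u v i ^+ (eps i : nat).
Proof. by apply: rmorph_mono => i; exact: clifford_lift_e. Qed.

Let X_mono (a : {ffun 'I_n -> nat}) : {mpoly K[n]} := 'X_[[multinom a i | i < n]].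

Lemma X_mono_lspan p : lspan X_mono p.
Proof.
rewrite [p]mpolyE; apply: lspan_sum => m _; apply: lspanZ.
have -> : 'X_[m] = X_mono [ffun i => m i].
  by congr 'X_[_]; apply/mnmP => i; rewrite mnmE ffunE.
exact: lspan_gen.
Qed.

Lemma group_elt_lspan (z : group_space K T n) : lspan (@group_elt K T n) z.
Proof. by exists z; exact: malg_lin_ext. Qed.

Let tensor_basis (p : hcc_index T n) :=
  let: (a, eps, g, eps', b) := p in
  tens (tens (tens (tens (X_mono a) (c_mono eps)) (group_elt K g)) (X_mono b))
    (e_mono eps').

Let tensor_basis_lspan z : lspan tensor_basis z.
Proof.
have cS := subalg_mono_lspan c2 cc (fun a => iff_refl (exists i, a = clif_c K i)).
have eS := subalg_mono_lspan e2 ee (fun a => iff_refl (exists i, a = clif_e K i)).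
have := tens_lspan (tens_lspan (tens_lspan (tens_lspan X_mono_lspan cS)
  group_elt_lspan) X_mono_lspan) eS z.
apply: lspan_sub => -[[[[a eps] g] b] eps'].
by exists (a, eps, g, eps', b).
Qed.

Lemma hcc_basis_is_basis : is_basis (@hcc_basis K T n t u v).
Proof. by split; [exact: hcc_basis_lin_indep | exact: hcc_basis_spanning]. Qed.

Lemma mul_map_bijective : bijective (mul_map T n t u v).
Proof.
apply: (linear_bijective tensor_basis_lspan hcc_basis_is_basis) => -[[[[a eps] g] eps'] b].
have [p pE] := polar_prod_comm b eps' (re_y re).
exists p; apply: etrans (mul_mapE t u v (X_mono a) (c_mono eps) (group_elt K g)
  (X_mono b) (e_mono eps')) _.
have eX : mul_X T n t u v (X_mono a) = \prod_(i < n) hcc_x T t u v i ^+ a i.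
  by apply: etrans (mpoly_liftX _ _ _) _; apply: eq_bigr => i _; rewrite mnmE.
have eY : mul_Y T n t u v (X_mono b) = \prod_(i < n) hcc_y T t u v i ^+ b i.
  by apply: etrans (mpoly_liftX _ _ _) _; apply: eq_bigr => i _; rewrite mnmE.
have eW : mul_W T n t u v (group_elt K g) = hcc_w t u v g by exact: lin_extU.
apply: etrans (mulr_swap_last eX (mul_c_mono eps) eW eY (mul_e_mono eps') pE) _.
exact: etrans (congr1 ( *%R^~ _) (esym (rmorph_sign _ _))) (pres_scalarE _ _).
Qed.

End Bijectivity.

Theorem theorem3p4 (R : realType) (T : weyl_type) (n : nat) (t u v : R[i])
    (n_gt0 : (0 < n)%N) :
  (exists (iX iY : {rmorphism {mpoly R[i][n]} -> hcc T n t u v})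
          (iC : {rmorphism clifford R[i] n -> hcc T n t u v})
          (iW : {linear group_space R[i] T n -> hcc T n t u v})
          (Phi : {linear ({mpoly R[i][n]} ⊗ clifford_c R[i] n
                    ⊗ group_space R[i] T n
                    ⊗ {mpoly R[i][n]} ⊗ clifford_e R[i] n)%type
                  -> hcc T n t u v}),
    [/\ [/\ scalable iX, scalable iY & scalable iC],
        (forall i, [/\ iX 'X_i = hcc_x T t u v i, iY 'X_i = hcc_y T t u v i,
                       iC (clif_c _ i) = hcc_c T t u v i
                     & iC (clif_e _ i) = hcc_e T t u v i]),
        (forall w, iW (group_elt _ w) = hcc_w t u v w),
        (forall p c w q e, Phi (p ⊗ c ⊗ w ⊗ q ⊗ e) =
           iX p * iC (subalg_val c) * iW w * iY q * iC (subalg_val e))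
      & bijective Phi])
  /\ is_basis (@hcc_basis R[i] T n t u v).
Proof.
split; last exact: hcc_basis_is_basis.
exists (mul_X T n t u v), (mul_Y T n t u v), (mul_C T n t u v),
  (mul_W T n t u v), (mul_map T n t u v).
split.
- split=> k a.
  + exact: etrans (mpoly_liftZ _ _ k a) (pres_scalarE k _).
  + exact: etrans (mpoly_liftZ _ _ k a) (pres_scalarE k _).
  + exact: etrans (clifford_liftZ _ _ k a) (pres_scalarE k _).
- move=> i; split.
  + exact: mpoly_liftXU.
  + exact: mpoly_liftXU.
  + exact: clifford_lift_c.
  + exact: clifford_lift_e.
- by move=> w; exact: lin_extU.
- exact: mul_mapE.
- exact: mul_map_bijective.
Qed.
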